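(* Let $G^{\nu}$ be a wconnected $\nu$-wgraph with $2\le\nu\le\omega$ (possibly $\nu=\vec{\omega}$), let $\rho\le\nu$ be either a natural number or $\omega$ (not $\vec{\omega}$), and let $S^{\rho}$ be a $\rho$-wsection of $G^{\nu}$. Then the enlargement ${}^{*}S^{\rho}$ either has exactly one $\rho$-galaxy, its principal one $\Gamma^{\rho}_{0}$, or has infinitely many $\rho$-galaxies.
   Context: Ranks and ordinals. Ranks are the natural numbers $0,1,2,\dots$, the formal rank $\vec{\omega}$ (larger than all natural numbers and smaller than $\omega$), and $\omega$. For a rank $\rho=\omega$, ''$\rho-1$'' means $\vec{\omega}$. Ordinals are in Cantor normal form and are added by natural (Hessenberg) summation. $\mathcal{F}$ is a fixed free ultrafilter on $\mathbb{N}$. Wgraphs. A $0$-graph is $\{X^{0},B\}$, with $X^{0}$ a set of $0$-nodes and $B$ a set of branches, i.e. two-element subsets of $X^0$. A $0$-walk is an alternating sequence $\langle\dots,x_m,b_m,x_{m+1},\dots\rangle$ of $0$-nodes and branches, indexed by consecutive integers, with $b_m$ incident to $x_m$ and $x_{m+1}$, ending at a $0$-node wherever it terminates; repetitions are allowed. It is two-ended (finite), one-ended (one-way infinite) or endless (two-way infinite). A $(-1)$-tip is an end of a branch; a $0$-node embraces itself and the $(-1)$-tips of its incident branches. Recursively, for a natural number $\rho$, a $\rho$-wtip is an equivalence class of one-ended $\rho$-walks, two being equivalent if they are identical from some point on, up to a shift of indices. Partition the set of all $\rho$-wtips into nonempty subsets $T_i$; a $(\rho+1)$-wnode is a set $T_i\cup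 N_i$, where $N_i$ is empty or a singleton whose member (the exceptional element) is a wnode of rank at most $\rho$, and each wnode is the exceptional element of at most one wnode of higher rank. A wnode embraces itself, its elements, and everything embraced by its exceptional element. For $\rho\ge1$, a $\rho$-walk is an alternating sequence $\langle\dots,x_m,W_m,x_{m+1},W_{m+1},\dots\rangle$ indexed by consecutive integers, where the nonterminal $x_m$ are $\rho$-wnodes, a terminal element (wherever the sequence terminates) is a wnode of rank at most $\rho$, and each $W_m$ is a nontrivial walk of rank at most $\rho-1$ that reaches $x_m$ on its left and $x_{m+1}$ on its right (i.e. on that side it either terminates at a wnode embraced by that wnode or is infinite with its wtip embraced by that wnode), such that for each nonterminal $x_m$ at least one of $W_{m-1},W_m$ reaches $x_m$ through a $(\rho-1)$-wtip. Two-ended, one-ended and endless are as for $0$-walks. An $\vec{\omega}$-wnode is a maximal infinite chain of wnodes of strictly increasing natural-number ranks, each the exceptional element of the next; it embraces everything its members embrace. A one-ended $\vec{\omega}$-walk is a sequence $\langle x_0,W_0,x_1,W_1,\dots\rangle$ with $x_m$ a wnode of natural-number rank $\mu_m$, $\mu_0<\mu_1<\cdots$, and $W_m$ a walk of rank less than $\mu_{m+1}$ reaching $x_m$ and $x_{m+1}$, the latter through a $(\mu_{m+1}-1)$-wtip; an endless one joins two of these at their starting wnodes; $\vec{\omega}$-wtips are classes of eventually identical one-ended $\vec{\omega}$-walks (up to merging consecutive pieces). Partition the set of all $\vec{\omega}$-wtips into nonempty subsets $T_i$; an $\omega$-wnode is a set $T_i\cup N_i$, where $N_i$ is empty or a singleton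 whose member (the exceptional element) is a wnode of rank at most $\vec{\omega}$, and each wnode is the exceptional element of at most one wnode of higher rank; an $\omega$-wnode embraces itself, its elements, and everything embraced by its exceptional element. An $\omega$-walk is an alternating sequence $\langle\dots,x_m,W_m,x_{m+1},W_{m+1},\dots\rangle$ indexed by consecutive integers, where the nonterminal $x_m$ are $\omega$-wnodes, a terminal element (wherever the sequence terminates) is a wnode of rank at most $\omega$, and each $W_m$ is a nontrivial walk of rank at most $\vec{\omega}$ that reaches $x_m$ on its left and $x_{m+1}$ on its right, such that for each nonterminal $x_m$ at least one of $W_{m-1},W_m$ reaches $x_m$ through an $\vec{\omega}$-wtip; it is two-ended, one-ended or endless according to whether the sequence is finite, one-way infinite or two-way infinite. A $\nu$-wgraph is $G^{\nu}=\{X^{0},B,X^{1},\dots,X^{\nu}\}$, with $X^{\gamma}$ the set of $\gamma$-wnodes, nonempty except possibly for $\gamma=\vec{\omega}$. It is wconnected if every two wnodes are the terminal wnodes of some two-ended walk in it. Lengths and wdistance. The length $|W|$ of a two-ended $0$-walk is its number of branch traversals. For a natural number or $\omega$ as rank $\gamma$, a one-ended $\gamma$-walk has length $\omega^{\gamma+1}$ and an endless one $\omega^{\gamma+1}\cdot2$; a one-ended (endless) $\vec{\omega}$-walk has length $\omega^{\omega}$ ($\omega^{\omega}\cdot 2$). A two-ended $\gamma$-walk with $\gamma\ge1$ has length the natural sum of the lengths of its constituent walks $W_m$. A wnode is maximal if it is not embraced by a wnode of higher rank. The wdistance is $d(x,y)=\min|W|$ over two-ended walks $W$ terminating at $x$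 and $y$, where a walk terminating at a wnode is also regarded as terminating at any wnode embracing it and wdistances from a nonmaximal wnode equal those from the maximal wnode embracing it; $d(x,y)=0$ if $x,y$ are embraced by the same maximal wnode. Wsections. A $\rho$-wsection $S^{\rho}$ of $G^{\nu}$ ($\rho<\nu$) is a maximal wsubgraph of the $\rho$-wgraph $\{X^{0},B,\dots,X^{\rho}\}$ that is $\rho$-wconnected: every two of its wnodes are joined by a two-ended $\alpha$-walk with $\alpha\le\rho$ ($\alpha<\vec{\omega}$ if $\rho=\vec{\omega}$). It consists of a set of branches together with the wnodes of rank at most $\rho$ embracing a tip having a representative in those branches. The only $\nu$-wsection is $G^{\nu}$ itself. A wsection $S^\rho$ is a $\rho$-wgraph by itself, with wdistance $d$. Enlargement. A $\gamma$-hypernode of ${}^{*}S^{\rho}$ is an equivalence class $\mathbf{x}=[x_n]$ of sequences of $\gamma$-wnodes of $S^{\rho}$, two sequences being equivalent if they agree on a set of indices in $\mathcal{F}$. A hyperbranch is a pair $\{[x_n],[y_n]\}$ of $0$-hypernodes with $\{n:\{x_n,y_n\}\text{ is a branch of }S^{\rho}\}\in\mathcal{F}$. The enlargement ${}^{*}S^{\rho}$ consists of all hypernodes of all ranks at most $\rho$ and all hyperbranches. A hypernode is standard if it is represented by a constant sequence. Galaxies. For $\rho$ a natural number or $\omega$, hypernodes $\mathbf{x}=[x_n]$ and $\mathbf{y}=[y_n]$ (of any ranks) are $\rho$-limitedly distant if there is $\mu\in\mathbb{N}$ with $\{n: d(x_n,y_n)\le\omega^{\rho}\cdot\mu\}\in\mathcal{F}$.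 This is an equivalence relation on hypernodes; its classes are the nodal $\rho$-galaxies, and a $\rho$-galaxy consists of the hypernodes of a nodal $\rho$-galaxy together with the hyperbranches whose $0$-hypernodes lie in it. The principal $\rho$-galaxy $\Gamma_0^{\rho}$ is the one whose hypernodes are $\rho$-limitedly distant from a standard hypernode. *)

(* Defs.v *)
From mathcomp Require Import all_boot all_order all_algebra all_classical.

Set Implicit Arguments.
Unset Strict Implicit.
Unset Printing Implicit Defensive.

Import Order.TTheory GRing.Theory Num.Theory.

Local Open Scope classical_set_scope.
Local Open Scope ring_scope.

(** * Ranks *)

(* [Arrow] is the formal rank written as an omega with an arrow on top: it
   lies above all natural numbers and below [Omega]. *)
Inductive wrank := Nat of nat | Arrow | Omega.

Definition rle (a b : wrank) : bool :=
  match a, b with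
  | Nat m, Nat n => (m <= n)%N
  | Nat _, _ => true
  | Arrow, Nat _ => false
  | Arrow, _ => true
  | Omega, Omega => true
  | Omega, _ => false
  end.

Definition rlt (a b : wrank) : bool := rle a b && ~~ rle b a.

(* The rank "a - 1"; for a = 0 it is the rank -1 of the tips of branches, and
   there is no such rank for a = Arrow; [None] stands for both. *)
Definition rpred (a : wrank) : option wrank :=
  match a with
  | Nat n.+1 => Some (Nat n)
  | Omega => Some Arrow
  | _ => None
  end.

(** * Lengths *)

(* The ordinal w^(w+1) * a + w^w * b + p(w), in Cantor normal form, is
   represented by ((a, b), p).  All the lengths lie below w^(w+2).  The natural
   (Hessenberg) sum is the addition of the product module, since it adds
   coefficients. *)
Definition cnf : Type := (nat * nat * {poly nat})%type.

Definition cnf_lt (u v : cnf) : Prop :=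
  let: (a, b, p) := u in
  let: (a', b', p') := v in
  (a < a')%N \/ a = a' /\ ((b < b')%N \/ b = b' /\
    exists k : nat, ((p`_k)%R < (p'`_k)%R)%N /\
      forall j : nat, (k < j)%N -> p`_j = p'`_j).

Definition cnf_le (u v : cnf) : Prop := u = v \/ cnf_lt u v.

(* w ^ r; the value at [Arrow] is never used. *)
Definition omega_pow (r : wrank) : cnf :=
  match r with
  | Nat k => (0%N, 0%N, 'X^k : {poly nat})
  | Arrow | Omega => (0%N, 1%N, 0)
  end.

Definition one_ended_length (r : wrank) : cnf :=
  match r with
  | Nat k => (0%N, 0%N, 'X^(k.+1) : {poly nat})
  | Arrow => (0%N, 1%N, 0)
  | Omega => (1%N, 0%N, 0)
  end.

(** * Sequences of wnodes and walks *)

(* [Walk r lo hi x w] is the alternating sequence < .., x m, w m, x (m+1), .. >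
   labelled with its rank r; the wnodes are the x m with lo <= m <= hi and the
   constituents are the w m with lo <= m < hi, [None] meaning that the sequence
   does not terminate on that side.  Values of x and w outside these ranges are
   irrelevant.  The constituents of a 0-walk are branch traversals:
   [Branch a b] traverses the branch {a, b} from a to b.  The conditions that
   make such a raw sequence a walk of a wgraph are in [is_walk] below. *)
Inductive walk (N : Type) : Type :=
  | Branch of N & N
  | Walk of wrank & option int & option int & (int -> N) & (int -> walk N).

Definition node_idx (lo hi : option int) (m : int) : bool :=
  (if lo is Some l then l <= m else true) &&
  (if hi is Some h then m <= h else true).

Definition link_idx (lo hi : option int) (m : int) : bool :=
  (if lo is Some l then l <= m else true) &&
  (if hi is Some h then m < h else true).

Definition inner_idx (lo hi : option int) (m : int) : bool :=
  (if lo is Some l then l < m else true) &&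
  (if hi is Some h then m < h else true).

Definition rank_of N (W : walk N) : option wrank :=
  if W is Walk r _ _ _ _ then Some r else None.

Definition nontrivial N (W : walk N) : Prop :=
  if W is Walk _ lo hi _ _ then exists m, link_idx lo hi m else True.

Fixpoint rev_walk N (W : walk N) : walk N :=
  match W with
  | Branch a b => Branch b a
  | Walk r lo hi x w =>
      Walk r (omap -%R hi) (omap -%R lo) (fun m => x (- m))
        (fun m => rev_walk (w (- m - 1)))
  end.

(* Equality of walks as sequences, disregarding the values outside the index
   ranges and the choice of the origin of the indices, at every level. *)
Inductive same_walk (N : Type) : walk N -> walk N -> Prop :=
  | SameBranch a b : same_walk (Branch a b) (Branch a b)
  | SameWalk r lo hi (x : int -> N) w (x' : int -> N) (w' : int -> walk N)
      (k : int) :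
      (forall m, node_idx lo hi m -> x' (m + k) = x m) ->
      (forall m, link_idx lo hi m -> same_walk (w m) (w' (m + k))) ->
      same_walk (Walk r lo hi x w)
        (Walk r (omap (+%R k) lo) (omap (+%R k) hi) x' w').

(* [traversal W p] is the oriented branch traversed by W at the position p,
   where p lists the indices to follow from W down to a branch, if p is such a
   list.  The order in which branches are traversed is the lexicographic
   order [pos_lt] on positions. *)
Fixpoint traversal N (W : walk N) (p : seq int) : option (N * N) :=
  match W, p with
  | Branch a b, [::] => Some (a, b)
  | Walk _ lo hi _ w, m :: q =>
      if link_idx lo hi m then traversal (w m) q else None
  | _, _ => None
  end.

Fixpoint pos_lt (p q : seq int) : bool :=
  match p, q with
  | a :: p', b :: q' => (a < b) || ((a == b) && pos_lt p' q')
  | _, _ => false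
  end.

(* W and V traverse the same branches in the same transfinite order: they
   coincide up to the way in which they are cut into consecutive pieces. *)
Definition same_up_to_merging N (W V : walk N) : Prop :=
  exists f : seq int -> seq int,
    [/\ forall p, traversal W p -> traversal V (f p) = traversal W p,
        forall p q, traversal W p -> traversal W q ->
          pos_lt p q -> pos_lt (f p) (f q)
      & forall q, traversal V q -> exists2 p, traversal W p & f p = q].

Definition drop_before N (m : int) (W : walk N) : walk N :=
  if W is Walk r _ hi x w then Walk r (Some m) hi x w else W.

Definition has_node_idx N (W : walk N) (m : int) : Prop :=
  if W is Walk _ lo hi _ _ then node_idx lo hi m else False.

(* The wtips are the classes of one-ended walks, infinite to the right, for
   this relation.  A walk that is infinite to the left has as its left wtip the
   right wtip of its reversal. *)
Definition wtip_equiv N (W V : walk N) : Prop :=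
  exists m n : int, [/\ has_node_idx W m, has_node_idx V n &
    if rank_of W is Some Arrow
    then same_up_to_merging (drop_before m W) (drop_before n V)
    else same_walk (drop_before m W) (drop_before n V)].

Fixpoint branches_in N (E : set (set N)) (W : walk N) : Prop :=
  match W with
  | Branch a b => E [set a; b]
  | Walk _ lo hi _ w => forall m, link_idx lo hi m -> branches_in E (w m)
  end.

(* Branches have length 1; the sum is the natural sum. *)
Fixpoint walk_length N (W : walk N) : cnf :=
  match W with
  | Branch _ _ => omega_pow (Nat 0)
  | Walk r (Some l) (Some h) _ w =>
      \sum_(i < `|h - l|%N) walk_length (w (l + i%:Z))
  | Walk r None None _ _ => one_ended_length r *+ 2
  | Walk r _ _ _ _ => one_ended_length r
  end.

(** * Wgraphs *)

(* The data of a wgraph; see [is_wgraph] for the conditions.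
   - [exc x] is the exceptional element of x, if x has one;
   - [tip_elt W x] means that the wtip represented by the one-ended walk W is an
     element of x;
   - [members x] is, when x is a wnode of rank Arrow, the chain that x is. *)
Record wstructure := WStructure {
  node : Type;
  rk : node -> wrank;
  branch : set (set node);
  exc : node -> option node;
  tip_elt : walk node -> set node;
  members : node -> set node
}.

(* The wnodes embraced by a wnode. *)
Inductive embraces (G : wstructure) (x : node G) : node G -> Prop :=
  | EmbSelf : embraces x x
  | EmbExc y z : embraces x y -> exc y = Some z -> embraces x z
  | EmbMember y z :
      embraces x y -> rk y = Arrow -> members y z -> embraces x z.

(* W is infinite to the right and its right wtip is embraced by x. *)
Definition tip_reaches_right (G : wstructure) (W : walk (node G)) (x : node G)
    : Prop :=
  if W is Walk _ lo None _ _ then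
    exists m y, [/\ node_idx lo None m, embraces x y &
                    tip_elt (drop_before m W) y]
  else False.

Definition reaches_right (G : wstructure) (W : walk (node G)) (x : node G)
    : Prop :=
  match W with
  | Branch _ b => embraces x b
  | Walk _ _ (Some h) y _ => embraces x (y h)
  | Walk _ _ None _ _ => tip_reaches_right W x
  end.

Definition reaches_left (G : wstructure) (W : walk (node G)) (x : node G) :=
  reaches_right (rev_walk W) x.

(* W reaches x through a wtip of rank (rk x) - 1. *)
Definition top_tip_right (G : wstructure) (W : walk (node G)) (x : node G) :=
  [/\ rpred (rk x) <> None, rank_of W = rpred (rk x) & tip_reaches_right W x].

Definition top_tip_left (G : wstructure) (W : walk (node G)) (x : node G) :=
  top_tip_right (rev_walk W) x.

Definition natural (r : wrank) : Prop := exists n, r = Nat n.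

Fixpoint is_walk (G : wstructure) (W : walk (node G)) : Prop :=
  match W with
  | Branch a b => branch [set a; b]
  | Walk r lo hi x w =>
    (exists m, node_idx lo hi m) /\
    (forall m, link_idx lo hi m -> is_walk (w m)) /\
    match r with
    | Nat 0 =>
        (forall m, node_idx lo hi m -> rk (x m) = Nat 0) /\
        (forall m, link_idx lo hi m -> w m = Branch (x m) (x (m + 1)))
    | Nat _.+1 | Omega =>
        [/\ forall m, node_idx lo hi m -> rle (rk (x m)) r,
            forall m, inner_idx lo hi m -> rk (x m) = r,
            forall m, link_idx lo hi m ->
              [/\ nontrivial (w m),
                  exists2 s, rank_of (w m) = Some s & rlt s r,
                  reaches_left (w m) (x m)
                & reaches_right (w m) (x (m + 1))]
          & forall m, inner_idx lo hi m ->
              top_tip_right (w (m - 1)) (x m) \/ top_tip_left (w m) (x m)]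
    | Arrow =>
        (* j is the index of the starting wnode, from which the sequence goes
           to infinity on at least one side, the ranks of the wnodes increasing
           outwards. *)
        (lo = None \/ hi = None) /\
        exists j : int,
          [/\ lo = None \/ lo = Some j,
              hi = None \/ hi = Some j,
              forall m, node_idx lo hi m -> natural (rk (x m)),
              forall m, link_idx lo hi m -> j <= m ->
                [/\ rlt (rk (x m)) (rk (x (m + 1))), reaches_left (w m) (x m)
                  & top_tip_right (w m) (x (m + 1))]
            & forall m, link_idx lo hi m -> m < j ->
                [/\ rlt (rk (x (m + 1))) (rk (x m)), top_tip_left (w m) (x m)
                  & reaches_right (w m) (x (m + 1))]]
    end
  end.

(* W is a one-ended walk of rank r, infinite to the right. *)
Definition one_ended (G : wstructure) (r : wrank) (W : walk (node G)) : Prop :=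
  is_walk W /\ exists l x w, W = Walk r (Some l) None x w.

Definition infinite_chain (G : wstructure) (C : set (node G)) : Prop :=
  exists c : nat -> node G,
    [/\ C = range c,
        forall n, natural (rk (c n)),
        forall n, rlt (rk (c n)) (rk (c n.+1))
      & forall n, exc (c n.+1) = Some (c n)].

Definition maximal_infinite_chain (G : wstructure) (C : set (node G)) : Prop :=
  infinite_chain C /\ forall D, infinite_chain D -> C `<=` D -> D = C.

Record is_wgraph (nu : wrank) (G : wstructure) : Prop := IsWGraph {
  wg_rank : forall x : node G, rle (rk x) nu;
  wg_nonempty : forall r, rle r nu -> r <> Arrow -> exists x : node G, rk x = r;
  wg_branch : forall b : set (node G), branch b ->
    exists x y, [/\ rk x = Nat 0, rk y = Nat 0, x <> y & b = [set x; y]];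
  (* The wtips of rank (rk x) - 1 are partitioned into nonempty sets, one for
     each wnode x of positive rank other than Arrow. *)
  wg_tip_one_ended : forall (W : walk (node G)) x, tip_elt W x ->
    exists2 r, one_ended r W & rpred (rk x) = Some r;
  wg_tip_class : forall r (W V : walk (node G)) x,
    one_ended r W -> one_ended r V -> wtip_equiv W V ->
    tip_elt W x -> tip_elt V x;
  wg_tip_cover : forall s r (W : walk (node G)),
    rle s nu -> rpred s = Some r -> one_ended r W -> exists x, tip_elt W x;
  wg_tip_disjoint : forall (W : walk (node G)) x y,
    tip_elt W x -> tip_elt W y -> x = y;
  wg_tip_nonempty : forall (x : node G) r, rpred (rk x) = Some r ->
    exists W, tip_elt W x;
  wg_exc : forall x y : node G, exc x = Some y ->
    rpred (rk x) <> None /\ rlt (rk y) (rk x);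
  wg_exc_inj : forall x x' y : node G,
    exc x = Some y -> exc x' = Some y -> x = x';
  (* The wnodes of rank Arrow are the maximal infinite chains. *)
  wg_arrow_chain : forall x : node G, rk x = Arrow ->
    maximal_infinite_chain (members x);
  wg_arrow_ext : forall x y : node G, rk x = Arrow -> rk y = Arrow ->
    members x = members y -> x = y;
  wg_arrow_all : forall C : set (node G), rle Arrow nu ->
    maximal_infinite_chain C -> exists2 x, rk x = Arrow & members x = C
}.

(** * Wconnectedness, wsections, wdistances *)

(* W is a two-ended walk of rank at most r, using only branches in E, that
   terminates at x and y, a walk that terminates at a wnode being regarded as
   terminating also at the wnodes that embrace it. *)
Definition joins (G : wstructure) (r : wrank) (E : set (set (node G)))
    (W : walk (node G)) (x y : node G) : Prop :=
  [/\ is_walk W, branches_in E W &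
      if W is Walk s (Some l) (Some h) u _
      then [/\ rle s r, embraces x (u l) & embraces y (u h)] else False].

Definition wconnected (nu : wrank) (G : wstructure) : Prop :=
  forall x y : node G, exists W, joins nu (@branch G) W x y.

(* A wsubgraph of the rho-wgraph {X^0, B, .., X^rho} induced by a set of
   branches; its wnodes are given by [sub_node]. *)
Record wsubgraph (G : wstructure) (rho : wrank) := WSubgraph {
  edges : set (set (node G))
}.

Definition sub_node (G : wstructure) (rho : wrank) (S : wsubgraph G rho)
    (x : node G) : Prop :=
  rle (rk x) rho /\ exists2 y, embraces x y &
    (exists2 b, edges S b & b y) \/
    (exists2 W, tip_elt W y & branches_in (edges S) W).

Definition rho_wconnected (G : wstructure) (rho : wrank) (S : wsubgraph G rho)
    : Prop :=
  forall x y, sub_node S x -> sub_node S y ->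
    exists W, joins rho (edges S) W x y.

Record is_wsection (G : wstructure) (rho : wrank) (S : wsubgraph G rho)
    : Prop := IsWSection {
  ws_edges : edges S `<=` @branch G;
  ws_nonempty : edges S !=set0;
  ws_connected : rho_wconnected S;
  ws_maximal : forall T : wsubgraph G rho, edges T `<=` @branch G ->
    rho_wconnected T -> edges S `<=` edges T -> edges T = edges S
}.

Definition maximal_node (G : wstructure) (rho : wrank) (S : wsubgraph G rho)
    (x : node G) : Prop :=
  sub_node S x /\
  ~ exists y, [/\ sub_node S y, rlt (rk x) (rk y) & embraces y x].

(* [l] is the wdistance in S between the maximal wnodes x and y. *)
Definition maximal_wdistance (G : wstructure) (rho : wrank)
    (S : wsubgraph G rho) (x y : node G) (l : cnf) : Prop :=
  (x = y /\ l = 0) \/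
  [/\ x <> y,
      exists2 W, joins rho (edges S) W x y & walk_length W = l
    & forall W, joins rho (edges S) W x y -> cnf_le l (walk_length W)].

Definition wdistance (G : wstructure) (rho : wrank) (S : wsubgraph G rho)
    (x y : node G) (l : cnf) : Prop :=
  exists x' y', [/\ maximal_node S x', embraces x' x, maximal_node S y',
                    embraces y' y & maximal_wdistance S x' y' l].

(** * Enlargements and galaxies *)

Definition free_ultrafilter (F : set_system nat) : Prop :=
  UltraFilter F /\ \bigcap_(A in F) A = set0.

Definition node_seq (G : wstructure) (rho : wrank) (S : wsubgraph G rho)
    (g : wrank) (x : nat -> node G) : Prop :=
  forall n, sub_node S (x n) /\ rk (x n) = g.

(* The g-hypernode [x_n], as an equivalence class. *)
Definition hyper_class (F : set_system nat) (G : wstructure) (rho : wrank)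
    (S : wsubgraph G rho) (g : wrank) (x : nat -> node G)
    : set (nat -> node G) :=
  [set y | node_seq S g y /\ F [set n | x n = y n]].

Definition hypernode (F : set_system nat) (G : wstructure) (rho : wrank)
    (S : wsubgraph G rho) (h : set (nat -> node G)) : Prop :=
  exists g x, node_seq S g x /\ h = hyper_class F S g x.

Definition standard (F : set_system nat) (G : wstructure) (rho : wrank)
    (S : wsubgraph G rho) (h : set (nat -> node G)) : Prop :=
  exists x : node G, sub_node S x /\ h = hyper_class F S (rk x) (fun=> x).

Definition hyperbranch (F : set_system nat) (G : wstructure) (rho : wrank)
    (S : wsubgraph G rho) (e : set (set (nat -> node G))) : Prop :=
  exists x y, [/\ node_seq S (Nat 0) x, node_seq S (Nat 0) y,
    F [set n | edges S [set x n; y n]] &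
    e = [set hyper_class F S (Nat 0) x; hyper_class F S (Nat 0) y]].

Definition limitedly_distant (F : set_system nat) (G : wstructure)
    (rho : wrank) (S : wsubgraph G rho) (h k : set (nat -> node G)) : Prop :=
  exists x y, [/\ h x, k y &
    exists mu : nat, F [set n | exists2 l, wdistance S (x n) (y n) l &
                                  cnf_le l (omega_pow rho *+ mu)]].

(* A galaxy is given by its hypernodes and its hyperbranches. *)
Record galaxy (N : Type) := Galaxy {
  galaxy_nodes : set (set (nat -> N));
  galaxy_branches : set (set (set (nat -> N)))
}.

Definition galaxy_of (F : set_system nat) (G : wstructure) (rho : wrank)
    (S : wsubgraph G rho) (H : set (set (nat -> node G))) : galaxy (node G) :=
  Galaxy H [set e | hyperbranch F S e /\ e `<=` H].

(* The set of the rho-galaxies of the enlargement of S. *)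
Definition galaxies (F : set_system nat) (G : wstructure) (rho : wrank)
    (S : wsubgraph G rho) : set (galaxy (node G)) :=
  [set A | exists2 h, hypernode F S h &
     A = galaxy_of F S
           [set k | hypernode F S k /\ limitedly_distant F S h k]].

Definition principal_galaxy (F : set_system nat) (G : wstructure)
    (rho : wrank) (S : wsubgraph G rho) : galaxy (node G) :=
  galaxy_of F S
    [set k | hypernode F S k /\
             exists2 h, standard F S h & limitedly_distant F S k h].

(* Main.v *)
Require Import Defs.
From mathcomp Require Import all_boot all_order all_algebra all_classical.
From mathcomp Require Import zify.

(* Count wdistances in multiples of w^rho.  The point is a triangle inequality up
   to the additive constant 2: two walks of rank rho that meet at a wnode y can be
   joined into one walk of rank rho, whose length exceeds the natural sum of their
   lengths by at most w^rho * 2.  The wnodes embraced by y form a chain, so if one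
   of the two constituents adjacent to y arrives through a wtip of rank rho - 1,
   the end of its walk at y has rank rho and can be kept as a wnode of the joined
   walk.  Otherwise the two constituents are themselves joined, by induction on the
   rank, into one constituent, and every constituent has length at most w^rho * 2.

   Fix a standard wnode x0.  If for every rank g the wdistances between x0 and the
   wnodes of rank g are bounded, all hypernodes are limitedly distant.  Otherwise
   there are wnodes u_0, u_1, .. of one rank g that move away from x0 so fast that
   u_i and u_j are at wdistance more than w^rho * i for i < j, and then the
   hypernodes [u_(n+j)]_n, for j = 0, 1, .., lie in distinct galaxies.  No symmetry
   of the wdistance is needed when both of its arguments are treated in turn. *)

Set Implicit Arguments.
Unset Strict Implicit.
Unset Printing Implicit Defensive.

Import Order.TTheory GRing.Theory Num.Theory.

(** * Cantor normal forms: order, natural sums, powers of w *)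

Section CantorNormalForms.
Local Open Scope ring_scope.

(** The last component of [cnf_lt]: p stands for the ordinal p(w), and the highest coefficient that
    differs decides. *)
Definition poly_lt (p q : {poly nat}) : Prop :=
  exists k : nat, ((p`_k)%R < (q`_k)%R)%N /\ forall j : nat, (k < j)%N -> p`_j = q`_j.

Lemma poly_lt_trans p q r : poly_lt p q -> poly_lt q r -> poly_lt p r.
Proof.
move=> [k [pqk pq]] [l [qrl qr]].
have [kl|lk|kl] := ltngtP k l.
- exists l; split=> [|j lj]; first by rewrite pq.
  by rewrite pq ?qr //; lia.
- exists k; split=> [|j kj]; first by rewrite -qr.
  by rewrite pq ?qr //; lia.
- subst l; exists k; split=> [|j kj]; first by lia.
  by rewrite pq ?qr.
Qed.

Lemma poly_lt_addr p q r : poly_lt p q -> poly_lt (p + r) (q + r).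
Proof.
move=> [k [pqk pq]]; exists k; split=> [|j kj]; rewrite !coefD; last by rewrite pq.
by rewrite ltn_add2r.
Qed.

Lemma poly_gt0 p : p <> 0 -> poly_lt 0 p.
Proof.
move=> /eqP p0; exists (size p).-1; split=> [|j pj].
  by rewrite coef0 lt0n -lead_coefE lead_coef_eq0.
by rewrite coef0 nth_default // (leq_trans (leqSpred _) pj).
Qed.

Lemma poly_lt_Xn k m n : (k < m)%N -> poly_lt ('X^k *+ n) 'X^m.
Proof.
move=> km; exists m; split=> [|j mj]; rewrite coefMn !coefXn.
  by rewrite eqxx gtn_eqF // mul0rn.
by rewrite !gtn_eqF ?mul0rn //; lia.
Qed.

Lemma cnf_lt_trans u v w : cnf_lt u v -> cnf_lt v w -> cnf_lt u w.
Proof.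
move: u v w => [[a b] p] [[a' b'] p'] [[a'' b''] p''] /=.
move=> [h1|[-> [h1|[-> h1]]]] [h2|[<- [h2|[<- h2]]]];
  try by [left; lia|right; split=> //; left; lia].
by right; split=> //; right; split=> //; exact: poly_lt_trans h2.
Qed.

Lemma cnf_le_refl u : cnf_le u u. Proof. by left. Qed.

Lemma cnf_le_trans u v w : cnf_le u v -> cnf_le v w -> cnf_le u w.
Proof.
move=> [->|uv] // [<-|vw]; first by right.
by right; exact: cnf_lt_trans vw.
Qed.

Lemma cnf_lt_addr u v w : cnf_lt u v -> cnf_lt (u + w) (v + w).
Proof.
move: u v w => [[a b] p] [[a' b'] p'] [[a'' b''] p''] /=.
move=> [h1|[-> [h1|[-> h1]]]].
- by left; rewrite ltn_add2r.
- by right; split=> //; left; rewrite ltn_add2r.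
- by right; split=> //; right; split=> //; exact: poly_lt_addr.
Qed.

Lemma cnf_leD u u' v v' : cnf_le u u' -> cnf_le v v' -> cnf_le (u + v) (u' + v').
Proof.
have addr x y z : cnf_le x y -> cnf_le (x + z) (y + z).
  by move=> [->|xy]; [left|right; exact: cnf_lt_addr].
move=> uu' vv'; apply: (cnf_le_trans (addr _ _ v uu')).
by rewrite ![u' + _]addrC; exact: addr.
Qed.

Lemma cnf_le0 u : cnf_le 0 u.
Proof.
move: u => [[a b] p]; rewrite /cnf_le /=.
have [->|a0] := posnP a; last by right; left.
have [->|b0] := posnP b; last by right; right; split=> //; left.
have [->|/eqP p0] := eqVneq p 0; first by left.
by right; right; split=> //; right; split=> //; exact: poly_gt0.
Qed.

Lemma cnf_le_addr u v : cnf_le u (u + v).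
Proof. by rewrite -{1}[u]addr0; exact: cnf_leD (cnf_le_refl _) (cnf_le0 _). Qed.

Lemma cnf_le_addl u v : cnf_le u (v + u).
Proof. by rewrite addrC; exact: cnf_le_addr. Qed.

Lemma cnf_leMn u m n : (m <= n)%N -> cnf_le (u *+ m) (u *+ n).
Proof. by move=> /subnK<-; rewrite mulrnDr; exact: cnf_le_addl. Qed.

Lemma cnf_leMn2 u v n : cnf_le u v -> cnf_le (u *+ n) (v *+ n).
Proof.
move=> uv; elim: n => [|n IH]; first by rewrite !mulr0n; exact: cnf_le_refl.
by rewrite !mulrSr; exact: cnf_leD.
Qed.

Lemma cnf_le_sum n (f : 'I_n -> cnf) u :
  (forall i, cnf_le (f i) u) -> cnf_le (\sum_(i < n) f i) (u *+ n).
Proof.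
elim: n f => [|n IH] f fu; first by rewrite big_ord0 mulr0n; exact: cnf_le_refl.
by rewrite big_ord_recr /= mulrSr; apply: cnf_leD => //; exact: IH.
Qed.

Lemma cnfMnE a b (p : {poly nat}) n :
  (a, b, p) *+ n = ((a * n)%N, (b * n)%N, p *+ n) :> cnf.
Proof.
elim: n => [|n IH]; first by rewrite !muln0 !mulr0n.
by rewrite !mulrSr IH !mulnSr.
Qed.

(** Lets any finite number of constituents be absorbed by one higher power. The pair [Arrow],
    [Omega] must be kept out, since [omega_pow] takes the value w^w at both. *)
Lemma omega_pow_lt s r n : s <> Arrow -> rlt s r -> r <> Arrow ->
  cnf_le (omega_pow s *+ n) (omega_pow r).
Proof.
case: s r => [k||] [m||] //= _; rewrite /rlt /=.
  move=> km _; right; rewrite cnfMnE !mul0n /=.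
  by right; split=> //; right; split=> //; apply: poly_lt_Xn; lia.
by move=> _ _; right; rewrite cnfMnE !mul0n /=; right; split=> //; left.
Qed.

Lemma omega_pow_le s r : s <> Arrow -> rle s r -> r <> Arrow ->
  cnf_le (omega_pow s) (omega_pow r).
Proof.
move=> sA sr rA; have [rs|/negP rs] := boolP (rle r s).
  suff -> : s = r by exact: cnf_le_refl.
  by case: s r sr rs {sA rA} => [m||] [n||] //= ? ?; congr Nat; lia.
rewrite -[omega_pow s]mulr1n; apply: omega_pow_lt => //.
by rewrite /rlt sr; apply/negP.
Qed.

(** For natural s the length is w^(s+1), and s < r gives s + 1 <= r; for [Arrow] below [Omega] both
    sides are w^w. *)
Lemma one_ended_length_le s r : rlt s r -> r <> Arrow ->
  cnf_le (one_ended_length s) (omega_pow r).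
Proof.
case: s r => [k||] [m||] //=; rewrite /rlt /=; last 1 first.
- by move=> _ _; left.
- move=> km _; have [->|km'] := eqVneq m k.+1; first by left.
  right; right; split=> //; right; split=> //.
  have := @poly_lt_Xn k.+1 m 1; rewrite mulr1n; apply; lia.
- by move=> _ _; right; right; split=> //; left.
Qed.

Local Open Scope classical_set_scope.

(** * Least elements of sets of Cantor normal forms *)

Lemma nat_least (A : set nat) : A !=set0 -> exists2 n, A n & forall m, A m -> (n <= m)%N.
Proof.
move=> [a Aa]; have ex : exists n, `[< A n >] by exists a; apply/asboolP.
exists (ex_minn ex); first by case: ex_minnP => n /asboolP.
by move=> m Am; case: ex_minnP => n _; apply; apply/asboolP.
Qed.

(** Induction on the number of low coefficients still undetermined: in the step, the highest of them
    is minimized first, and the polynomials attaining that minimum agree in one more coefficient. *)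
Lemma poly_least_agree n (A : set {poly nat}) : A !=set0 ->
  (forall p q, A p -> A q -> forall j, (n <= j)%N -> p`_j = q`_j) ->
  exists2 p, A p & forall q, A q -> p = q \/ poly_lt p q.
Proof.
elim: n A => [|n IH] A [p Ap] Aeq.
  exists p => // q Aq; left; apply/polyP => j; exact: Aeq.
have [|_ [p1 Ap1 <-] c1] := @nat_least [set q`_n | q in A].
  by exists p`_n, p.
have [||p2 [Ap2 p2n] min2] := IH [set q | A q /\ q`_n = p1`_n].
- by exists p1.
- move=> q r [Aq qn] [Ar rn] j; rewrite leq_eqVlt => /orP[/eqP<-|nj].
    by rewrite qn rn.
  exact: Aeq.
exists p2 => // q Aq.
have := c1 _ (imageP _ Aq); rewrite leq_eqVlt => /orP[/eqP qn|qn].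
  exact: min2.
right; exists n; split; first by rewrite p2n.
by move=> j nj; apply: Aeq.
Qed.

(** A polynomial of larger size is larger, so only those of size at most [size p0] compete, and
    their coefficients all vanish from that index on. *)
Lemma poly_least (A : set {poly nat}) : A !=set0 ->
  exists2 p, A p & forall q, A q -> p = q \/ poly_lt p q.
Proof.
move=> [p0 Ap0].
have [||p [Ap sp] minp] := @poly_least_agree (size p0)
    [set q | A q /\ (size q <= size p0)%N].
- by exists p0.
- move=> p q [_ sp] [_ sq] j sj.
  by rewrite !nth_default //; [exact: leq_trans sq sj|exact: leq_trans sp sj].
exists p => // q Aq.
have [sq|sq] := leqP (size q) (size p0); first exact: minp.
have spq : (size p <= (size q).-1)%N.
  by apply: (leq_trans sp); rewrite -ltnS (ltn_predK sq).
right; exists (size q).-1; split.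
  rewrite nth_default // -lead_coefE lt0n lead_coef_eq0 -size_poly_gt0.
  exact: leq_ltn_trans sq.
move=> j sj; rewrite !nth_default //; last exact: leq_trans spq (ltnW sj).
exact: leq_trans (leqSpred _) sj.
Qed.

(** Three successive minimizations, following the lexicographic order of the components. This is why
    the minimum in a wdistance is attained. *)
Lemma cnf_least (A : set cnf) : A !=set0 ->
  exists2 u, A u & forall v, A v -> cnf_le u v.
Proof.
move=> [u0 Au0].
have [|_ [[[a b0] p0] A0 <-] mina] := @nat_least [set v.1.1 | v in A].
  by exists u0.1.1, u0.
have [|_ [[[a' b] p1] [A1 /= ea] <-] minb] :=
    @nat_least [set v.1.2 | v in [set v | A v /\ v.1.1 = a]].
  by exists b0, (a, b0, p0).
move: A1; rewrite {a'}ea => A1.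
have [|p Ap minp] := @poly_least [set p | A (a, b, p)]; first by exists p1.
exists (a, b, p) => // -[[a2 b2] p2] A2.
have := mina _ (imageP _ A2); rewrite /= leq_eqVlt => /orP[/eqP ea|lta]; last first.
  by right; left.
subst a2; have : (b <= b2)%N by apply: minb; exists (a, b2, p2).
rewrite leq_eqVlt => /orP[/eqP eb|ltb]; last by right; right; split=> //; left.
subst b2; have [->|lp] := minp _ A2; first by left.
by right; right; split=> //; right.
Qed.

End CantorNormalForms.

(** * The order on ranks *)

Section Ranks.

Lemma rle_refl a : rle a a. Proof. by case: a => /=. Qed.

Lemma rle_trans b a c : rle a b -> rle b c -> rle a c.
Proof. by case: a b c => [?||] [?||] [?||] //=; exact: leq_trans. Qed.

Lemma rle_anti a b : rle a b -> rle b a -> a = b.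
Proof. by case: a b => [m||] [n||] //= ? ?; congr Nat; lia. Qed.

Lemma rltNge a b : rlt a b = ~~ rle b a.
Proof. by case: a b => [m||] [n||] //=; rewrite /rlt /=; lia. Qed.

Lemma rltW a b : rlt a b -> rle a b.
Proof. by move=> /andP[]. Qed.

Lemma rlt_irr a : ~ rlt a a.
Proof. by rewrite rltNge rle_refl. Qed.

Lemma rle_lt_trans b a c : rle a b -> rlt b c -> rlt a c.
Proof. by rewrite !rltNge => ab; apply: contra => /rle_trans; apply. Qed.

Lemma rlt_le_trans b a c : rlt a b -> rle b c -> rlt a c.
Proof. by rewrite !rltNge => ab bc; apply: contra ab => /(rle_trans bc). Qed.

Lemma rlt_trans b a c : rlt a b -> rlt b c -> rlt a c.
Proof. by move=> ab /rltW; exact: rlt_le_trans. Qed.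

Lemma rle_eqVlt a b : rle a b -> a = b \/ rlt a b.
Proof.
by move=> ab; rewrite rltNge; have [/(rle_anti ab)|] := boolP (rle b a); [left|right].
Qed.

Lemma rle_natural a n : rle a (Nat n) -> natural a.
Proof. by case: a => //= m _; exists m. Qed.

Lemma rlt_natural a b : rlt a b -> natural b -> natural a.
Proof. by move=> /rltW ab [n nb]; apply: (@rle_natural _ n); rewrite -nb. Qed.

Lemma rpred_inj a b s : rpred a = Some s -> rpred b = Some s -> a = b.
Proof. by case: a b s => [[|n]||] [[|m]||] //= s [<-] // [->]. Qed.

(* [Arrow] is excluded because there is no rank immediately below it. *)
Lemma rlt_pred_le a b s : rpred a = Some s -> b <> Arrow -> rlt s b -> rle a b.
Proof.
by case: a b s => [[|n]||] [[|m]||] // s [<-] _; rewrite rltNge //=; lia.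
Qed.

Lemma rlt_rpred a s : rlt s a -> a <> Arrow -> rpred a <> None.
Proof. by case: a s => [[|n]||] [m||] //; rewrite rltNge. Qed.

End Ranks.

(** * Embracing: the wnodes below a given wnode, and those above it, form chains *)

Section Embracing.
Local Open Scope classical_set_scope.
Variables (nu : wrank) (G : wstructure).
Hypothesis hG : is_wgraph nu G.
Implicit Types x y z : node G.

Lemma embraces_trans y x z : embraces x y -> embraces y z -> embraces x z.
Proof.
move=> xy yz; elim: yz => // [a b _ xa ab|a b _ xa ra ab].
  exact: EmbExc xa ab.
exact: EmbMember xa ra ab.
Qed.

Lemma embraces_exc x y : exc x = Some y -> embraces x y.
Proof. by move=> xy; exact: EmbExc (EmbSelf x) xy. Qed.

Lemma embraces_member x y : rk x = Arrow -> members x y -> embraces x y.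
Proof. by move=> rx xy; exact: EmbMember (EmbSelf x) rx xy. Qed.

Lemma arrow_members x : rk x = Arrow -> exists c : nat -> node G,
  [/\ members x = range c, forall n, natural (rk (c n)),
      forall n, rlt (rk (c n)) (rk (c n.+1)) &
      forall n, exc (c n.+1) = Some (c n)].
Proof. by move=> rx; have [[c cP] _] := wg_arrow_chain hG rx; exists c. Qed.

Lemma exc_rlt x y : exc x = Some y -> rlt (rk y) (rk x).
Proof. by move=> /(wg_exc hG) []. Qed.

Lemma exc_not_arrow x y : exc x = Some y -> rk x <> Arrow.
Proof. by move=> /(wg_exc hG) [+ _] rx; rewrite rx. Qed.

Lemma member_rlt x y : rk x = Arrow -> members x y -> rlt (rk y) (rk x).
Proof.
move=> rx; have [c [-> cnat _ _]] := arrow_members rx => -[n _ <-].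
by rewrite rx; have [k ->] := cnat n.
Qed.

Lemma embraces_rank x y : embraces x y -> x = y \/ rlt (rk y) (rk x).
Proof.
elim=> [|a b _ xa ab|a b _ xa ra ab]; first by left.
- right; have ba := exc_rlt ab.
  by case: xa => [->//|ax]; exact: rlt_trans ax.
- right; have ba := member_rlt ra ab.
  by case: xa => [->//|ax]; exact: rlt_trans ax.
Qed.

Lemma embraces_rle x y : embraces x y -> rle (rk y) (rk x).
Proof. by move=> /embraces_rank [->|/rltW //]; exact: rle_refl. Qed.

(** The constructors of [embraces] add steps at the lower end; this exposes the first step down from
    x instead. *)
Lemma embraces_head x y : embraces x y ->
  [\/ x = y, exists2 a, exc x = Some a & embraces a y |
      rk x = Arrow /\ exists2 a, members x a & embraces a y].
Proof.
elim=> [|a b _ IH ab|a b _ IH ra ab]; first by constructor 1.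
- case: IH => [xa|[c xc ca]|[rx [c xc ca]]].
  + by subst a; constructor 2; exists b => //; exact: EmbSelf.
  + by constructor 2; exists c => //; exact: EmbExc ca ab.
  + by constructor 3; split=> //; exists c => //; exact: EmbExc ca ab.
- case: IH => [xa|[c xc ca]|[rx [c xc ca]]].
  + by subst a; constructor 3; split=> //; exists b => //; exact: EmbSelf.
  + by constructor 2; exists c => //; exact: EmbMember ca ra ab.
  + by constructor 3; split=> //; exists c => //; exact: EmbMember ca ra ab.
Qed.

Lemma chain_embraces (c : nat -> node G) :
  (forall n, exc (c n.+1) = Some (c n)) ->
  forall m n, (m <= n)%N -> embraces (c n) (c m).
Proof.
move=> cS m n /subnK <-; elim: (n - m)%N => [|k IH]; first exact: EmbSelf.
by rewrite addSn; apply: embraces_trans IH; exact: embraces_exc.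
Qed.

(** The only way down from [c k.+1] is to [c k], so an embraced wnode is met either on the way down
    to [c m] or below it. *)
Lemma chain_comparable (c : nat -> node G) :
  (forall n, exc (c n.+1) = Some (c n)) ->
  forall m n y, (m <= n)%N -> embraces (c n) y ->
  embraces (c m) y \/ embraces y (c m).
Proof.
move=> cS m n y mn; rewrite -(subnK mn).
elim: (n - m)%N => [|k IH]; first by left.
rewrite addSn => /embraces_head [<-|[a]|[rc _]].
- by right; rewrite -addSn; apply: chain_embraces => //; rewrite leq_addl.
- by rewrite cS => -[<-]; exact: IH.
- by case: (exc_not_arrow (cS (k + m)%N)).
Qed.

(** Downwards there is no branching: a wnode has at most one exceptional element, and one of rank
    [Arrow] only leads into its chain. *)
Lemma embraced_comparable x y z : embraces x y -> embraces x z ->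
  embraces y z \/ embraces z y.
Proof.
elim=> [|a b xa IH ab|a b xa IH ra ab] xz; first by left.
- have [az|za] := IH xz; last by right; exact: EmbExc za ab.
  have [<-|[c]|[ra _]] := embraces_head az.
  + by right; exact: embraces_exc.
  + by rewrite ab => -[->]; left.
  + by case: (exc_not_arrow ab).
- have [az|za] := IH xz; last by right; exact: EmbMember za ra ab.
  have [<-|[c ac]|[_ [d ad dz]]] := embraces_head az.
  + by right; exact: embraces_member.
  + by case: (exc_not_arrow ac).
  have [c [mc _ _ cS]] := arrow_members ra.
  move: ab ad; rewrite mc => -[m _ bE] [n _ dE]; subst b d.
  have [mn|/ltnW nm] := leqP m n; first exact: chain_comparable cS _ _ _ mn dz.
  by left; apply: embraces_trans dz; exact: chain_embraces.
Qed.

Lemma embraced_same_rank x y z : embraces x y -> embraces x z ->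
  rk y = rk z -> y = z.
Proof.
move=> xy xz yz; have [e|e] := embraced_comparable xy xz;
  by case: (embraces_rank e) => // /[!yz] /rlt_irr.
Qed.

Lemma embraces_rle_embraces x y z : embraces x y -> embraces x z ->
  rle (rk z) (rk y) -> embraces y z.
Proof.
move=> xy xz zy; have [//|e] := embraced_comparable xy xz.
have [->|] := embraces_rank e; first exact: EmbSelf.
by rewrite rltNge zy.
Qed.

Lemma arrow_chain_up x y z : rk x = Arrow -> members x y -> exc z = Some y ->
  members x z.
Proof.
move=> rx; have [c [-> _ _ cS]] := arrow_members rx => -[n _ <-] zc.
by exists n.+1 => //; exact: (wg_exc_inj hG (cS n) zc).
Qed.

(* Two maximal infinite chains that share a member are equal, since a chain is
   determined by its lowest member and can be prolonged downwards. *)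
Lemma arrow_unique x x' y : rk x = Arrow -> rk x' = Arrow ->
  members x y -> members x' y -> x = x'.
Proof.
move=> rx rx'.
have [c [mc cnat clt cS]] := arrow_members rx.
have [c' [mc' cnat' clt' cS']] := arrow_members rx'.
rewrite mc mc' => -[m _ cm] [n _ cn].
(* The chains coincide up to the shift q - p: downwards because [exc] is a function, upwards because
   it is injective. *)
have sub (d d' : nat -> node G) p q : (forall i, exc (d i.+1) = Some (d i)) ->
    (forall i, exc (d' i.+1) = Some (d' i)) -> d p = d' q -> (p <= q)%N ->
    range d `<=` range d'.
  move=> dS dS' dpq pq; have dn j : (j <= p)%N -> d (p - j)%N = d' (q - j)%N.
    elim: j => [|j IH] jp; first by rewrite !subn0.
    have dj := dS (p - j.+1)%N; have dj' := dS' (q - j.+1)%N.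
    have e1 : (p - j.+1).+1 = (p - j)%N by lia.
    have e2 : (q - j.+1).+1 = (q - j)%N by lia.
    move: dj; rewrite e1 IH; last by lia.
    by rewrite -e2 dj' => -[].
  have up j : d (p + j)%N = d' (q + j)%N.
    elim: j => [|j IH]; first by rewrite !addn0.
    rewrite !addnS; apply: (wg_exc_inj hG (dS _)).
    by rewrite dS' IH.
  move=> _ [j _ <-]; have [pj|jp] := leqP p j.
    by exists (q + (j - p))%N => //; rewrite -up subnKC.
  exists (q - (p - j))%N => //; rewrite -dn; last by lia.
  by congr d; lia.
have [_ maxx] := wg_arrow_chain hG rx.
have [_ maxx'] := wg_arrow_chain hG rx'.
have inf : infinite_chain (members x) by exists c.
have inf' : infinite_chain (members x') by exists c'.
apply: (wg_arrow_ext hG rx rx').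
have [mn|/ltnW nm] := leqP m n.
  symmetry; apply: maxx => //; rewrite mc mc'.
  by apply: sub mn => //; rewrite cm.
apply: maxx' => //; rewrite mc mc'.
by apply: sub nm => //; rewrite cm.
Qed.

(** Embracing with the number of steps recorded, so that an induction can run on the total length of
    two paths. *)
Inductive embraces_in x : nat -> node G -> Prop :=
  | EmbIn0 : embraces_in x 0 x
  | EmbInExc n y z : embraces_in x n y -> exc y = Some z -> embraces_in x n.+1 z
  | EmbInMember n y z : embraces_in x n y -> rk y = Arrow -> members y z ->
      embraces_in x n.+1 z.

Lemma embraces_inP x y : embraces x y <-> exists n, embraces_in x n y.
Proof.
split=> [|[n]].
  elim=> [|a b _ [n xa] ab|a b _ [n xa] ra ab].
  - by exists 0%N; exact: EmbIn0.
  - by exists n.+1; exact: EmbInExc xa ab.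
  - by exists n.+1; exact: EmbInMember xa ra ab.
elim=> [|k a b _ xa ab|k a b _ xa ra ab]; first exact: EmbSelf.
- exact: EmbExc xa ab.
- exact: EmbMember xa ra ab.
Qed.

(** Upwards there is no branching either. The last steps of both paths into z are removed: they
    start at the same wnode if they are of the same kind; if z is the exceptional element of one
    wnode and a member of a chain, that wnode belongs to the chain too, which still shortens the
    paths. *)
Lemma embracing_comparable x y z : embraces x z -> embraces y z ->
  embraces x y \/ embraces y x.
Proof.
move=> /embraces_inP[m xz] /embraces_inP[n yz].
have [N] := ubnP (m + n)%N; elim: N => // N IH in m n z xz yz *.
case: m z / xz yz => [|m a z xa az|m a z xa ra az] yz.
- by move=> _; right; apply/embraces_inP; exists n.
- case: n z / yz az => [|n b z yb bz|n b z yb rb bz] az.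
  + by move=> _; left; apply/embraces_inP; exists m.+1; exact: EmbInExc xa az.
  + have ab := wg_exc_inj hG az bz; subst b => mnN.
    by apply: IH xa yb _; lia.
  + move=> mnN; apply: (IH _ _ _ xa (EmbInMember yb rb (arrow_chain_up rb bz az))).
    by lia.
- case: n z / yz az => [|n b z yb bz|n b z yb rb bz] az.
  + by move=> _; left; apply/embraces_inP; exists m.+1; exact: EmbInMember xa ra az.
  + move=> mnN; apply: (IH _ _ _ (EmbInMember xa ra (arrow_chain_up ra az bz)) yb).
    by lia.
  + have ab := arrow_unique ra rb az bz; subst b => mnN.
    by apply: IH xa yb _; lia.
Qed.

End Embracing.

(** * Existence and uniqueness of maximal wnodes *)

Section MaximalWnodes.
Local Open Scope classical_set_scope.
Variables (nu : wrank) (G : wstructure).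
Hypothesis hG : is_wgraph nu G.
Implicit Types x y z : node G.

(** Descending along [exc] lowers a natural rank, hence stops. The lowest wnode found is where the
    chain of [unbounded_arrow] starts. *)
Lemma embraces_bottom x : natural (rk x) ->
  exists2 b, embraces x b & exc b = None.
Proof.
move=> [n rx]; have [N] := ubnP n; elim: N => // N IH in x n rx *.
move=> nN; case ex : (exc x) => [y|]; last by exists x => //; exact: EmbSelf.
have := exc_rlt hG ex; rewrite rx; case ry : (rk y) => [m||] // mn.
have [|b yb eb] := IH _ _ ry; first by move: mn; rewrite rltNge /=; lia.
by exists b => //; exact: embraces_trans (embraces_exc ex) yb.
Qed.

(* If the ranks of the wnodes embracing x are natural and unbounded, these
   wnodes make up, with those embraced by x, a maximal infinite chain, that is,
   a wnode of rank Arrow. *)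
Lemma unbounded_arrow x (A : set (node G)) : rle Arrow nu -> A x ->
  (forall y, A y -> embraces y x /\ natural (rk y)) ->
  (forall n, exists2 y, A y & rlt (Nat n) (rk y)) ->
  exists2 a, rk a = Arrow & embraces a x.
Proof.
move=> arr Ax AP Aunb.
have [b xb eb] := embraces_bottom (AP _ Ax).2.
(* From every wnode between b and a member of A there is one more step up within this set; iterating
   it from b gives the chain. *)
pose Q y := exists a, [/\ A a, embraces a y & embraces y b].
have [f fP] : exists f : node G -> node G,
    forall y, Q y -> exc (f y) = Some y /\ Q (f y).
  suff /choice[f fP] : forall y, exists z, Q y -> exc z = Some y /\ Q z by exists f.
  move=> y; have [[a [Aa ay yb]]|] := pselect (Q y); last by exists y.
  have [ax anat] := AP _ Aa.
  have [k ry] : natural (rk y).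
    have [<-//|] := embraces_rank hG ay.
    by move=> /rlt_natural; exact.
  have [a' Aa' ka'] := Aunb k; have [a'x a'nat] := AP _ Aa'.
  have a'y : embraces a' y.
    have [aa'|a'a] := embracing_comparable hG ax a'x; last exact: embraces_trans ay.
    apply: (embraces_rle_embraces hG aa' ay); rewrite ry; exact: rltW.
  (* The last step from a' down to y must come from a wnode with exceptional element y: a' outranks
     y, and no wnode of rank [Arrow] lies below one of natural rank. *)
  case: {-1}_ / a'y (erefl y) => [ya'|z w a'z zw wy|z w a'z rz _ _].
  - by move: ka'; rewrite -ya' ry => /rlt_irr.
  - subst w; exists z => _; split=> //; exists a'; split=> //.
    exact: embraces_trans (embraces_exc zw) yb.
  - have := embraces_rle hG a'z; rewrite rz.
    by have [m ->] := a'nat.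
pose c n := iter n f b.
have Qc n : Q (c n).
  elim: n => [|n /fP[]//]; exists x; split=> //; exact: EmbSelf.
have cS n : exc (c n.+1) = Some (c n) by have [] := fP _ (Qc n).
have clt n : rlt (rk (c n)) (rk (c n.+1)) by exact: (exc_rlt hG (cS n)).
have cnat n : natural (rk (c n)).
  have [a [Aa ay _]] := Qc n; have [_ anat] := AP _ Aa.
  by have [<-//|/rlt_natural] := embraces_rank hG ay; exact.
have cmax : maximal_infinite_chain (range c).
  split; first by exists c.
  (* A chain containing this one has b as its lowest member, because [exc b = None]; above b both
     are determined by the injectivity of [exc]. *)
  move=> _ [d [-> dnat dlt dS]] cd.
  have [j _ dj] : range d b by apply: cd; exists 0%N.
  have d0 : d 0%N = b.
    by case: j dj => // j dj; move: (dS j); rewrite dj eb.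
  have dc n : d n = c n.
    by elim: n => // n IH; apply: (wg_exc_inj hG (dS n)); rewrite IH.
  by have -> : d = c by apply/funext.
have [a ra mem] := wg_arrow_all hG arr cmax.
exists a => //; have [k rx] := (AP _ Ax).2.
have cge n : rle (Nat n) (rk (c n)).
  elim: n => [|n IH]; first by case: (rk _).
  have := rle_lt_trans IH (clt n); rewrite rltNge.
  by case: (rk _) => [m||] //=; lia.
have ack : embraces a (c k.+1).
  by apply: embraces_member => //; rewrite mem; exists k.+1.
apply: (embraces_trans ack).
have [_ [_ _ cb]] := Qc k.+1.
have [//|xc] := embracing_comparable hG cb xb.
have := rle_trans (cge k.+1) (embraces_rle hG xc).
by rewrite rx /= ltnn.
Qed.

(** A wnode of greatest rank in A is as required. If there were none, the ranks in A would be
    natural and unbounded, hence rho would be [Omega], and [unbounded_arrow] would put a wnode of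
    rank [Arrow] into A. *)
Lemma maximal_embracing rho x : rle rho nu -> rho <> Arrow -> rle (rk x) rho ->
  exists x', [/\ embraces x' x, rle (rk x') rho &
    forall y, embraces y x' -> rle (rk y) rho -> y = x'].
Proof.
move=> rhonu rhoA xrho.
pose A := [set y | embraces y x /\ rle (rk y) rho].
have Ax : A x by split=> //; exact: EmbSelf.
have top y : A y -> (forall z, A z -> rle (rk z) (rk y)) ->
    exists x', [/\ embraces x' x, rle (rk x') rho &
      forall y, embraces y x' -> rle (rk y) rho -> y = x'].
  move=> [yx yrho] ytop; exists y; split=> // z zy zrho.
  have [//|] := embraces_rank hG zy.
  by rewrite rltNge ytop //; split=> //; exact: embraces_trans yx.
have [[y Ay ry]|noOm] := pselect (exists2 y, A y & rk y = Omega).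
  by apply: (top y) => // z _; rewrite ry; case: (rk z).
have [[y Ay ry]|noArr] := pselect (exists2 y, A y & rk y = Arrow).
  apply: (top y) => // z Az; rewrite ry; case rz : (rk z) => //.
  by case: noOm; exists z.
have Anat y : A y -> natural (rk y).
  move=> Ay; case ry : (rk y) => [m||]; first by exists m.
  - by case: noArr; exists y.
  - by case: noOm; exists y.
have [[N AN]|unb] := pselect (exists N, forall y, A y -> rle (rk y) (Nat N)).
  (* The least element k of K gives the greatest rank N - k. *)
  pose K := [set k | exists2 y, A y & rk y = Nat (N - k)%N].
  have [|k [y Ay ry] kmin] := @nat_least K.
    have [n rx] := Anat _ Ax; exists (N - n)%N, x => //.
    by rewrite subKn //; have := AN _ Ax; rewrite rx.
  apply: (top y) => // z Az; rewrite ry.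
  have [m rz] := Anat _ Az; rewrite rz /=.
  have mN : (m <= N)%N by have := AN _ Az; rewrite rz.
  have : (k <= N - m)%N by apply: kmin; exists z => //; rewrite rz subKn.
  lia.
have rhoOm : rho = Omega.
  case erho : rho rhoA => [m||] // _; case: unb; exists m => y [_].
  by rewrite erho.
have [||||a ra ax] := @unbounded_arrow x A.
- by apply: rle_trans rhonu; rewrite rhoOm.
- exact: Ax.
- by move=> y Ay; split; [case: Ay|exact: Anat].
- move=> n; apply: contrapT => small; case: unb; exists n => y Ay.
  by apply: contrapT => /negP; rewrite -rltNge => lt; case: small; exists y.
case: noArr; exists a => //; split=> //; by rewrite ra rhoOm.
Qed.

Variables (rho : wrank) (S : wsubgraph G rho).
Hypotheses (rho_nu : rle rho nu) (rho_arrow : rho <> Arrow).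

Lemma maximal_node_exists x : sub_node S x ->
  exists2 x', maximal_node S x' & embraces x' x.
Proof.
move=> [xrho [y xy yS]].
have [x' [x'x x'rho x'max]] := maximal_embracing rho_nu rho_arrow xrho.
exists x' => //; split.
  by split=> //; exists y => //; exact: embraces_trans xy.
move=> [z [[zrho _] x'z zx']].
by move: x'z; rewrite (x'max z) // => /rlt_irr.
Qed.

(** Of two wnodes embracing z one embraces the other, and maximality excludes a larger rank. Hence a
    wdistance has no choice of maximal wnodes. *)
Lemma maximal_node_unique x y z : maximal_node S x -> maximal_node S y ->
  embraces x z -> embraces y z -> x = y.
Proof.
move=> [Sx xmax] [Sy ymax] xz yz.
have [xy|yx] := embracing_comparable hG xz yz.
  have [//|lt] := embraces_rank hG xy.
  by case: ymax; exists x.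
have [//|lt] := embraces_rank hG yx.
by case: xmax; exists y.
Qed.

End MaximalWnodes.

(** * Reversal of walks *)

Section Reversal.
Local Open Scope ring_scope.
Variable G : wstructure.
Implicit Types (W V : walk (node G)) (lo hi : option int) (m : int).
Implicit Types (x : int -> node G) (w : int -> walk (node G)).

Lemma node_idx_rev lo hi m :
  node_idx (omap -%R hi) (omap -%R lo) m = node_idx lo hi (- m).
Proof. by case: lo hi => [l|] [h|] //=; rewrite /node_idx /=; lia. Qed.

Lemma link_idx_rev lo hi m :
  link_idx (omap -%R hi) (omap -%R lo) m = link_idx lo hi (- m - 1).
Proof. by case: lo hi => [l|] [h|] //=; rewrite /link_idx /=; lia. Qed.

Lemma inner_idx_rev lo hi m :
  inner_idx (omap -%R hi) (omap -%R lo) m = inner_idx lo hi (- m).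
Proof. by case: lo hi => [l|] [h|] //=; rewrite /inner_idx /=; lia. Qed.

Lemma rev_walkK W : rev_walk (rev_walk W) = W.
Proof.
elim: W => //= r lo hi x w IH; congr Walk.
- by case: lo => //= l; rewrite opprK.
- by case: hi => //= h; rewrite opprK.
- by apply/funext => m; rewrite opprK.
- by apply/funext => m; rewrite IH; congr w; lia.
Qed.

Lemma rank_of_rev W : rank_of (rev_walk W) = rank_of W.
Proof. by case: W. Qed.

Lemma nontrivial_rev W : nontrivial W -> nontrivial (rev_walk W).
Proof.
case: W => //= r lo hi _ _ [m lm]; exists (- m - 1).
by rewrite link_idx_rev; apply: etrans lm; congr link_idx; lia.
Qed.

Lemma reaches_left_rev W z : reaches_left (rev_walk W) z = reaches_right W z.
Proof. by rewrite /reaches_left rev_walkK. Qed.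

Lemma top_tip_left_rev W z : top_tip_left (rev_walk W) z = top_tip_right W z.
Proof. by rewrite /top_tip_left rev_walkK. Qed.

Definition succ_links r lo hi x w : Prop :=
  [/\ forall m, node_idx lo hi m -> rle (rk (x m)) r,
      forall m, inner_idx lo hi m -> rk (x m) = r,
      forall m, link_idx lo hi m ->
        [/\ nontrivial (w m),
            exists2 s, rank_of (w m) = Some s & rlt s r,
            reaches_left (w m) (x m)
          & reaches_right (w m) (x (m + 1))]
    & forall m, inner_idx lo hi m ->
        top_tip_right (w (m - 1)) (x m) \/ top_tip_left (w m) (x m)].

Definition arrow_links lo hi x w (j : int) : Prop :=
  [/\ lo = None \/ lo = Some j,
      hi = None \/ hi = Some j,
      forall m, node_idx lo hi m -> natural (rk (x m)),
      forall m, link_idx lo hi m -> j <= m ->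
        [/\ rlt (rk (x m)) (rk (x (m + 1))), reaches_left (w m) (x m)
          & top_tip_right (w m) (x (m + 1))]
    & forall m, link_idx lo hi m -> m < j ->
        [/\ rlt (rk (x (m + 1))) (rk (x m)), top_tip_left (w m) (x m)
          & reaches_right (w m) (x (m + 1))]].

(** The condition [rpred r <> None] singles out the positive natural ranks and [Omega], which can
    thus be treated together. *)
Lemma is_walk_succ r lo hi x w : rpred r <> None ->
  is_walk (Walk r lo hi x w) <->
  [/\ exists m, node_idx lo hi m, forall m, link_idx lo hi m -> is_walk (w m)
    & succ_links r lo hi x w].
Proof. by case: r => [[|n]||] //= _; split=> [[? []]|[]]. Qed.

Lemma is_walk_arrow lo hi x w :
  is_walk (Walk Arrow lo hi x w) <->
  [/\ exists m, node_idx lo hi m, forall m, link_idx lo hi m -> is_walk (w m),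
      lo = None \/ hi = None & exists j, arrow_links lo hi x w j].
Proof. by split=> [[? [? []]]|[]]. Qed.

(** All conditions are symmetric under the exchange of left and right, with m replaced by -m for
    wnodes and by -m - 1 for constituents. Statements about right ends thereby yield those about
    left ends. *)
Lemma is_walk_rev W : is_walk W -> is_walk (rev_walk W).
Proof.
elim: W => [a b|r lo hi x w IH]; first by rewrite /= setUC.
have nodes : (exists m, node_idx lo hi m) ->
    exists m, node_idx (omap -%R hi) (omap -%R lo) m.
  by move=> [m mi]; exists (- m); rewrite node_idx_rev opprK.
have links : (forall m, link_idx lo hi m -> is_walk (w m)) ->
    forall m, link_idx (omap -%R hi) (omap -%R lo) m ->
    is_walk (rev_walk (w (- m - 1))).
  by move=> lw m; rewrite link_idx_rev => /lw; exact: IH.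
have succ : succ_links r lo hi x w -> succ_links r (omap -%R hi) (omap -%R lo)
    (fun m => x (- m)) (fun m => rev_walk (w (- m - 1))).
  move=> [A B C D]; split=> m.
  - by rewrite node_idx_rev => /A.
  - by rewrite inner_idx_rev => /B.
  - rewrite link_idx_rev => /C [nt rr l l']; split.
    + exact: nontrivial_rev.
    + by rewrite rank_of_rev.
    + rewrite reaches_left_rev.
      by rewrite subrK in l'.
    + by rewrite -[reaches_right _ _]/(reaches_left _ _) opprD.
  - rewrite inner_idx_rev => /D [t|t]; [right|left].
    + rewrite top_tip_left_rev; exact: t.
    + rewrite -[top_tip_right _ _]/(top_tip_left _ _).
      by rewrite opprB addrC addKr.
case: r succ => [[|n]||] succ.
- move=> [ex [lw [A B]]]; split; first exact: nodes.
  split; first exact: links.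
  split=> m; first by rewrite node_idx_rev => /A.
  rewrite link_idx_rev => /B -> /=; congr Branch; congr x; lia.
- move=> /(is_walk_succ _ _ _ _ (r := Nat n.+1)) [] // ex lw A.
  apply/is_walk_succ => //; split; [exact: nodes|exact: links|exact: succ].
- move=> /is_walk_arrow [ex lw inf [j [A B C D E]]].
  apply/is_walk_arrow; split; [exact: nodes|exact: links|by case: inf => ->; [right|left]|].
  exists (- j); split=> [||m|m|m].
  + by case: B => ->; [left|right].
  + by case: A => ->; [left|right].
  + by rewrite node_idx_rev => /C.
  + rewrite link_idx_rev => /E {}E jm; have [|rl tl rr] := E; first by lia.
    split.
    * by rewrite opprD; rewrite subrK in rl.
    * by rewrite reaches_left_rev; rewrite subrK in rr.
    * by rewrite -[top_tip_right _ _]/(top_tip_left _ _) opprD.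
  + rewrite link_idx_rev => /D {}D jm; have [|rl tl rr] := D; first by lia.
    split.
    * by rewrite opprD; rewrite subrK in rl.
    * by rewrite top_tip_left_rev; rewrite subrK in rr.
    * by rewrite -[reaches_right _ _]/(reaches_left _ _) opprD.
- move=> /(is_walk_succ _ _ _ _ (r := Omega)) [] // ex lw A.
  apply/is_walk_succ => //; split; [exact: nodes|exact: links|exact: succ].
Qed.

Lemma branches_in_rev E W : branches_in E W -> branches_in E (rev_walk W).
Proof.
elim: W => [a b|r lo hi x w IH] /=; first by rewrite setUC.
by move=> wE m; rewrite link_idx_rev => /wE; exact: IH.
Qed.

End Reversal.

(** * Wtips depend only on tails *)

Section Tips.
Local Open Scope ring_scope.

Lemma same_walk_refl N (W : walk N) : same_walk W W.
Proof.
elim: W => [a b|r lo hi x w IH]; first exact: SameBranch.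
have add0 (o : option int) : omap (+%R 0) o = o by case: o => //= l; rewrite add0r.
rewrite -{2}(add0 lo) -{2}(add0 hi).
by apply: SameWalk => m _; rewrite addr0.
Qed.

Section OneWgraph.
Variables (nu : wrank) (G : wstructure).
Hypothesis hG : is_wgraph nu G.
Implicit Types (W V : walk (node G)) (lo hi : option int) (m : int).
Implicit Types (x : int -> node G) (w : int -> walk (node G)).

Lemma same_tail_wtip_equiv r p k x w x' w' :
  (forall m, p <= m -> x' (m + k) = x m /\ w' (m + k) = w m) ->
  wtip_equiv (Walk r (Some p) None x w) (Walk r (Some (p + k)) None x' w').
Proof.
move=> tail; exists p, (p + k); split; rewrite /= /node_idx ?lexx //.
have same : same_walk (Walk r (Some p) None x w)
    (Walk r (Some (p + k)) None x' w').
  have -> : p + k = k + p by rewrite addrC.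
  apply: (@SameWalk _ r (Some p) None x w x' w' k) => m;
    rewrite /node_idx /link_idx /= andbT => /tail [ex ew] //.
  by rewrite ew; exact: same_walk_refl.
case: r same => [n||] // _.
(* At rank [Arrow] a map of positions is needed. Only the leading index is shifted, as the
   constituents themselves are equal. *)
pose f (s : seq int) := if s is m :: q then (m + k) :: q else [::].
have trav m q : traversal (Walk Arrow (Some (p + k)) None x' w') (m + k :: q) =
    traversal (Walk Arrow (Some p) None x w) (m :: q).
  rewrite /= /link_idx /= !andbT lerD2r; case: ifP => // pm.
  by have [_ ->] := tail _ pm.
exists f; split.
- by move=> [|m q] // _; exact: trav.
- move=> [|m q] // [|m' q'] // _ _ /=.
  by rewrite ltrD2r (inj_eq (addIr k)).
- move=> [|m q] // t; exists (m - k :: q); last by rewrite /= subrK.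
  by rewrite -trav subrK.
Qed.

(** Only tails far enough out are claimed: at rank [Arrow] they have to begin at or beyond the
    starting wnode, from which the ranks increase. *)
Lemma drop_walk r lo x w : is_walk (Walk r lo None x w) ->
  exists M, node_idx lo None M /\
    forall m, M <= m -> is_walk (Walk r (Some m) None x w).
Proof.
have nodes (p q : int) m : node_idx lo None p -> p <= q -> node_idx (Some q) None m ->
    node_idx lo None m by rewrite /node_idx; case: (lo) => [l|] /=; lia.
have links (p q : int) m : node_idx lo None p -> p <= q -> link_idx (Some q) None m ->
    link_idx lo None m by rewrite /node_idx /link_idx; case: (lo) => [l|] /=; lia.
have inners (p q : int) m : node_idx lo None p -> p <= q -> inner_idx (Some q) None m ->
    inner_idx lo None m by rewrite /node_idx /inner_idx; case: (lo) => [l|] /=; lia.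
have ex q : exists m, node_idx (Some q) None m.
  by exists q; rewrite /node_idx lexx.
have succ (p q : int) : node_idx lo None p -> p <= q ->
    succ_links r lo None x w -> succ_links r (Some q) None x w.
  move=> mp pq [A B C D]; split=> m.
  - by move=> /(nodes _ _ _ mp pq) /A.
  - by move=> /(inners _ _ _ mp pq) /B.
  - by move=> /(links _ _ _ mp pq) /C.
  - by move=> /(inners _ _ _ mp pq) /D.
case: r succ => [[|n]||] succ.
- move=> [[p mp] [lw [A B]]]; exists p; split=> // q pq; split=> //.
  split; first by move=> m /(links _ _ _ mp pq) /lw.
  split=> m; first by move=> /(nodes _ _ _ mp pq) /A.
  by move=> /(links _ _ _ mp pq) /B.
- move=> /(is_walk_succ _ _ _ _ (r := Nat n.+1)) [] // [p mp] lw A.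
  exists p; split=> // q pq; apply/is_walk_succ => //; split=> //.
    by move=> m /(links _ _ _ mp pq) /lw.
  exact: succ mp pq A.
- move=> /is_walk_arrow [[p mp] lw _ [j [A _ B C D]]].
  have mp' : node_idx lo None (Num.max p j).
    by move: mp; rewrite /node_idx; case: (lo) => [l|] //=; lia.
  exists (Num.max p j); split=> // q pq; apply/is_walk_arrow; split=> //.
  + by move=> m /(links _ _ _ mp' pq) /lw.
  + by right.
  exists q; split=> [||m|m lm qm|m]; [by right|by left|..].
  + by move=> mi; exact: (B _ (nodes _ _ _ mp' pq mi)).
  + by apply: C; [exact: (links _ _ _ mp' pq lm)|lia].
  + by rewrite /link_idx /=; lia.
- move=> /(is_walk_succ _ _ _ _ (r := Omega)) [] // [p mp] lw A.
  exists p; split=> // q pq; apply/is_walk_succ => //; split=> //.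
    by move=> m /(links _ _ _ mp pq) /lw.
  exact: succ mp pq A.
Qed.

(** A wtip is a class of eventually equal walks, so changes before the index M do not affect what is
    reached at infinity. This carries the outer ends through all cuts and splices below. *)
Lemma tip_reaches_right_tail r lo lo' x w x' w' M k z :
  is_walk (Walk r lo' None x' w') ->
  (forall m, M <= m -> x' (m + k) = x m /\ w' (m + k) = w m) ->
  tip_reaches_right (Walk r lo None x w) z ->
  tip_reaches_right (Walk r lo' None x' w') z.
Proof.
move=> isV tail [m [y [mi zy ty]]].
have [s [isW [l [x1 [w1 [es _ _ _]]]]] _] := wg_tip_one_ended hG ty; subst s.
have [M1 [M1i dropV]] := drop_walk isV.
have [M2 [M2i dropW]] := drop_walk isW.
(* Beyond p the walks agree and both tails are walks; p also lies beyond the index m at which the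
   wtip is given. *)
pose p := Num.max (Num.max m M) (Num.max (M1 - k) M2).
have pi : node_idx lo' None (p + k).
  by move: M1i; rewrite /node_idx /p; case: (lo') => [l'|] //=; lia.
exists (p + k), y; split=> //.
have oneW : one_ended r (Walk r (Some p) None x w).
  by split; [apply: dropW; rewrite /p; lia|exists p, x, w].
have oneV : one_ended r (Walk r (Some (p + k)) None x' w').
  by split; [apply: dropV; rewrite /p; lia|exists (p + k), x', w'].
apply: (wg_tip_class hG oneW oneV).
  by apply: same_tail_wtip_equiv => q pq; apply: tail; move: pq; rewrite /p; lia.
apply: (wg_tip_class hG _ oneW _ ty).
  by split=> //; exists m, x, w.
have equiv : wtip_equiv (Walk r (Some p) None x w) (Walk r (Some (p + 0)) None x w).
  by apply: same_tail_wtip_equiv => q _; rewrite addr0.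
exists p, p; split; rewrite /= /node_idx ?lexx //=; first by rewrite /p; lia.
have := equiv; rewrite addr0 => -[a [b [_ _]]] _.
case: (r) => [n||]; try exact: same_walk_refl.
by exists id; split=> // q t; exists q.
Qed.

(** Here b is the wnode that has the wtip as an element; its rank is one above that of the walk. *)
Lemma tip_reaches_right_rank W z : tip_reaches_right W z ->
  exists b r, [/\ embraces z b, tip_reaches_right W b, rank_of W = Some r &
    rpred (rk b) = Some r].
Proof.
case: W => // r lo [] // x w [m [y [mi zy ty]]].
have [s [_ [l [x1 [w1 [es _ _ _]]]]] rs] := wg_tip_one_ended hG ty; subst s.
by exists y, r; split=> //; exists m, y; split=> //; exact: EmbSelf.
Qed.

End OneWgraph.
End Tips.

(** * Ends of walks, gluing and wrapping *)

Section Gluing.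
Local Open Scope ring_scope.
Variables (nu : wrank) (G : wstructure).
Hypothesis hG : is_wgraph nu G.
Implicit Types (W V Z : walk (node G)) (lo hi : option int) (m k l h : int).
Implicit Types (x : int -> node G) (w : int -> walk (node G)) (z y c : node G).

Definition lfin W : bool := if W is Walk _ None _ _ _ then false else true.
Definition rfin W : bool := if W is Walk _ _ None _ _ then false else true.

Lemma rfin_rev W : rfin (rev_walk W) = lfin W.
Proof. by case: W => // r [l|] hi x w. Qed.

Lemma lfin_rev W : lfin (rev_walk W) = rfin W.
Proof. by case: W => // r lo [h|] x w. Qed.

Lemma reaches_right_up W z z' : embraces z' z -> reaches_right W z ->
  reaches_right W z'.
Proof.
move=> zz'; case: W => [a b|r lo [h|] x w] /=; try exact: embraces_trans zz'.
by move=> [m [y [mi zy ty]]]; exists m, y; split=> //; exact: embraces_trans zy.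
Qed.

Lemma reaches_left_up W z z' : embraces z' z -> reaches_left W z ->
  reaches_left W z'.
Proof. exact: reaches_right_up. Qed.

Lemma reaches_right_tip W z : ~~ rfin W ->
  reaches_right W z <-> tip_reaches_right W z.
Proof. by case: W => [a b|r lo [h|] x w]. Qed.

Lemma tip_reaches_right_rfin W z : tip_reaches_right W z -> ~~ rfin W.
Proof. by case: W => [a b|r lo [h|] x w]. Qed.

Lemma top_tip_rightP W z s : rpred (rk z) = Some s -> rank_of W = Some s ->
  ~~ rfin W -> reaches_right W z -> top_tip_right W z.
Proof.
move=> rz rW fW rr; split; [by rewrite rz|by rewrite rz|].
exact/reaches_right_tip.
Qed.

Lemma top_tip_leftP W z s : rpred (rk z) = Some s -> rank_of W = Some s ->
  ~~ lfin W -> reaches_left W z -> top_tip_left W z.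
Proof.
move=> rz rW fW; apply: top_tip_rightP rz _ _; first by rewrite rank_of_rev.
by rewrite rfin_rev.
Qed.

Lemma top_tip_right_reaches W z : top_tip_right W z -> reaches_right W z.
Proof.
by move=> [_ _ t]; apply/reaches_right_tip => //; exact: tip_reaches_right_rfin t.
Qed.

Lemma top_tip_left_reaches W z : top_tip_left W z -> reaches_left W z.
Proof. exact: top_tip_right_reaches. Qed.

Lemma top_tip_left_lfin W z : top_tip_left W z -> ~~ lfin W.
Proof. by move=> [_ _ /tip_reaches_right_rfin]; rewrite rfin_rev. Qed.

Lemma top_tip_right_rfin W z : top_tip_right W z -> ~~ rfin W.
Proof. by move=> [_ _ /tip_reaches_right_rfin]. Qed.

Lemma walk_node_rank r lo hi x w m : is_walk (Walk r lo hi x w) ->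
  node_idx lo hi m -> rle (rk (x m)) r /\ (r = Arrow -> natural (rk (x m))).
Proof.
case: r => [[|n]||].
- by move=> [_ [_ [A _]]] mi; rewrite A.
- by move=> [_ [_ [A _ _ _]]] mi; split=> //; exact: A.
- by move=> [_ [_ [_ [j [_ _ A _ _]]]]] /A [n rn]; split=> [|_]; [rewrite rn|exists n].
- by move=> [_ [_ [A _ _ _]]] mi; split=> //; exact: A.
Qed.

Lemma walk_nodes r lo hi x w : is_walk (Walk r lo hi x w) ->
  exists m, node_idx lo hi m.
Proof. by case: r => [[|n]||] []. Qed.

Lemma walk_links r lo hi x w m : is_walk (Walk r lo hi x w) ->
  link_idx lo hi m -> is_walk (w m).
Proof. by case: r => [[|n]||] [_ [lw _]]; exact: lw. Qed.

(** The wnode b is where the walk really arrives: its terminal wnode, or the wnode that contains its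
    wtip. *)
Lemma reaches_right_end W s z : is_walk W -> rank_of W = Some s ->
  reaches_right W z -> exists b, [/\ embraces z b, reaches_right W b,
    rfin W -> rle (rk b) s & ~~ rfin W -> rpred (rk b) = Some s].
Proof.
move=> isW rW; have [fW|fW] := boolP (rfin W).
  case: W isW rW fW => [a b|r lo [h|] x w] isW // [<-] _ zx.
  exists (x h); split=> // [|_]; first exact: EmbSelf.
  apply: (walk_node_rank isW _).1.
  by have [m] := walk_nodes isW; rewrite /node_idx lexx; case: (lo) => [l|] //=; lia.
move=> /(reaches_right_tip z fW) /(tip_reaches_right_rank hG) [b [r [zb tb rb pb]]].
move: rb; rewrite rW => -[sr]; exists b; split=> //; first exact/reaches_right_tip.
by rewrite sr.
Qed.

(** In both cases of [reaches_right_end] the rank of b is at most r, so b can serve as the terminal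
    wnode of an r-walk with constituent W. *)
Lemma reaches_right_node W s r z : is_walk W -> rank_of W = Some s ->
  rlt s r -> r <> Arrow -> reaches_right W z ->
  exists b, [/\ embraces z b, reaches_right W b & rle (rk b) r].
Proof.
move=> isW rW sr rA /(reaches_right_end isW rW) [b [zb rb fb ib]].
exists b; split=> //; have [/fb bs|/ib pb] := boolP (rfin W).
  by apply: rle_trans bs _; exact: rltW.
exact: rlt_pred_le pb rA sr.
Qed.

Lemma reaches_left_node W s r z : is_walk W -> rank_of W = Some s ->
  rlt s r -> r <> Arrow -> reaches_left W z ->
  exists b, [/\ embraces z b, reaches_left W b & rle (rk b) r].
Proof.
move=> /is_walk_rev isW; rewrite -rank_of_rev; exact: reaches_right_node.
Qed.

Lemma reaches_right_agree r lo lo' hi x w x' w' M k z :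
  is_walk (Walk r lo' (omap (+%R k) hi) x' w') ->
  (forall m, M <= m -> x' (m + k) = x m /\ w' (m + k) = w m) ->
  (if hi is Some h then x' (h + k) = x h else True) ->
  reaches_right (Walk r lo hi x w) z ->
  reaches_right (Walk r lo' (omap (+%R k) hi) x' w') z.
Proof.
move=> isV tail; case: hi isV => [h|] isV /=; first by rewrite addrC => ->.
by move=> _; exact: (tip_reaches_right_tail hG isV tail).
Qed.

Lemma reaches_left_agree r lo hi hi' x w x' w' M z :
  is_walk (Walk r lo hi' x' w') ->
  (forall m, m <= M -> x' m = x m /\ w' m = w m) ->
  (if lo is Some l then x' l = x l else True) ->
  reaches_left (Walk r lo hi x w) z -> reaches_left (Walk r lo hi' x' w') z.
Proof.
move=> /is_walk_rev /= isV tail; rewrite /reaches_left /=.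
case: lo isV => [l|] isV /=; first by rewrite opprK => ->.
move=> _; apply: (tip_reaches_right_tail hG (M := - M) (k := 0) isV) => m Mm.
rewrite !addr0; split; first by apply: (tail _ _).1; lia.
by congr rev_walk; apply: (tail _ _).2; lia.
Qed.

Lemma walk_two_nodes r x w l h : is_walk (Walk r (Some l) (Some h) x w) -> l <= h.
Proof. by move=> /walk_nodes [m]; rewrite /node_idx; lia. Qed.

Definition glue T (p k : int) (a b : int -> T) (m : int) : T :=
  if m < p then a m else b (m - k).

Definition upd T (f : int -> T) (l : int) (c : T) (m : int) : T :=
  if m == l then c else f m.

(** The first walk may be cut at an index h before its end h', and the junction wnode is [x2 l]. The
    last hypothesis collects what [is_walk] demands there; all other conditions are inherited. *)
Lemma glue_succ r lo1 h' h x1 w1 l hi2 x2 w2 : rpred r <> None ->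
  is_walk (Walk r lo1 (Some h') x1 w1) -> h <= h' -> node_idx lo1 None h ->
  is_walk (Walk r (Some l) hi2 x2 w2) ->
  (link_idx lo1 None (h - 1) -> reaches_right (w1 (h - 1)) (x2 l) /\
    (link_idx (Some l) hi2 l -> rk (x2 l) = r /\
      (top_tip_right (w1 (h - 1)) (x2 l) \/ top_tip_left (w2 l) (x2 l)))) ->
  is_walk (Walk r lo1 (omap (+%R (h - l)) hi2)
    (glue h (h - l) x1 x2) (glue h (h - l) w1 w2)).
Proof.
move=> rr /(is_walk_succ _ _ _ _ rr) [_ lw1 [A1 B1 C1 D1]] hh' hi.
move=> /(is_walk_succ _ _ _ _ rr) [[p pi] lw2 [A2 B2 C2 D2]] J.
have lhi : node_idx (Some l) hi2 l.
  by move: pi; rewrite /node_idx; case: (hi2) => [q|] /=; lia.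
apply/(is_walk_succ _ _ _ _ rr); split.
- exists h; move: lhi hi; rewrite /node_idx; case: (lo1) (hi2) => [a|] [b|] /=; lia.
- rewrite /glue => m mi; case: ltP => mh.
    by apply: lw1; move: mi; rewrite /link_idx; case: (lo1) (hi2) => [a|] [b|] /=; lia.
  by apply: lw2; move: mi; rewrite /link_idx; case: (lo1) (hi2) => [a|] [b|] /=; lia.
split; rewrite /glue => m mi.
- case: ltP => mh.
    by apply: A1; move: mi; rewrite /node_idx; case: (lo1) (hi2) => [a|] [b|] /=; lia.
  by apply: A2; move: mi; rewrite /node_idx; case: (lo1) (hi2) => [a|] [b|] /=; lia.
- case: ltP => mh.
    by apply: B1; move: mi; rewrite /inner_idx; case: (lo1) (hi2) => [a|] [b|] /=; lia.
  have [mh'|mh'] := eqVneq m h.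
    subst m; have [|_ []] := J.
    + by move: mi; rewrite /link_idx /inner_idx; case: (lo1) (hi2) => [a|] [b|] /=; lia.
    + by move: mi; rewrite /link_idx /inner_idx; case: (lo1) (hi2) => [a|] [b|] /=; lia.
    + by have -> : h - (h - l) = l by lia.
  by apply: B2; move: mi; rewrite /inner_idx; case: (lo1) (hi2) => [a|] [b|] /=; lia.
- have [mh|mh] := ltP m h.
    have m1 : link_idx lo1 (Some h') m.
      by move: mi; rewrite /link_idx; case: (lo1) (hi2) => [a|] [b|] /=; lia.
    have [nt rw rl rr'] := C1 _ m1; split=> //.
    have [//|hm] := ltP (m + 1) h; have em : m = h - 1 by lia.
    have -> : m + 1 - (h - l) = l by lia.
    rewrite em; apply: (J _).1.
    by move: m1; rewrite em /link_idx; case: (lo1) => [a|] /=; lia.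
  have -> : (m + 1 < h) = false by lia.
  have -> : m + 1 - (h - l) = m - (h - l) + 1 by lia.
  by apply: C2; move: mi; rewrite /link_idx; case: (lo1) (hi2) => [a|] [b|] /=; lia.
- have [mh|mh] := ltP m h.
    have -> : (m - 1 < h) = true by lia.
    by apply: D1; move: mi; rewrite /inner_idx; case: (lo1) (hi2) => [a|] [b|] /=; lia.
  have [mh'|mh'] := eqVneq m h.
    subst m; have -> : (h - 1 < h) = true by lia.
    have -> : h - (h - l) = l by lia.
    have [|_ []//] := J.
    + by move: mi; rewrite /link_idx /inner_idx; case: (lo1) (hi2) => [a|] [b|] /=; lia.
    + by move: mi; rewrite /link_idx /inner_idx; case: (lo1) (hi2) => [a|] [b|] /=; lia.
  have -> : (m - 1 < h) = false by lia.
  have -> : m - 1 - (h - l) = m - (h - l) - 1 by lia.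
  by apply: D2; move: mi; rewrite /inner_idx; case: (lo1) (hi2) => [a|] [b|] /=; lia.
Qed.

(** The last hypothesis is needed at the second wnode, whose tip condition may have been met by the
    replaced constituent only. *)
Lemma set_first_succ r l hi x w c Z s : rpred r <> None ->
  is_walk (Walk r (Some l) hi x w) -> link_idx (Some l) hi l ->
  rle (rk c) r -> is_walk Z -> nontrivial Z -> rank_of Z = Some s -> rlt s r ->
  reaches_left Z c -> reaches_right Z (x (l + 1)) ->
  (rk (x (l + 1)) = r -> top_tip_right (w l) (x (l + 1)) ->
    top_tip_right Z (x (l + 1))) ->
  is_walk (Walk r (Some l) hi (upd x l c) (upd w l Z)).
Proof.
move=> rr /(is_walk_succ _ _ _ _ rr) [ex lw [A B C D]] li cr isZ ntZ rZ sr Zl Zr Zt.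
apply/(is_walk_succ _ _ _ _ rr); split=> //.
  by rewrite /upd => m mi; case: eqP => // _; exact: lw.
split; rewrite /upd => m mi.
- by case: eqP => // _; exact: A.
- case: eqP => [ml|_]; last exact: B.
  by move: mi; rewrite ml /inner_idx ltxx.
- have [ml|ml] := eqVneq m l.
    subst m; have -> : (l + 1 == l) = false by lia.
    by split=> //; exists s.
  have -> : (m + 1 == l) = false by move: mi; rewrite /link_idx; lia.
  exact: C.
- have [ml|ml] := eqVneq m l.
    by subst m; move: mi; rewrite /inner_idx ltxx.
  have [ml1|ml1] := eqVneq (m - 1) l; last exact: D.
  have em : m = l + 1 by lia.
  have := D _ mi; rewrite ml1 em => -[t|t]; [left|by right].
  by apply: Zt => //; apply: B; rewrite -em.
Qed.

(** With a single constituent there are no inner wnodes and hence no tip condition. *)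
Lemma wrap r s V z1 z2 : r <> Arrow -> is_walk V -> nontrivial V ->
  rank_of V = Some s -> rlt s r -> reaches_left V z1 -> reaches_right V z2 ->
  exists a b, let W := Walk r (Some 0) (Some 1) (fun m => if m == 0 then a else b)
      (fun=> V) in
    [/\ is_walk W, reaches_left W z1 & reaches_right W z2].
Proof.
move=> rA isV ntV rV sr Vl Vr.
have [a [za Va ra]] := reaches_left_node isV rV sr rA Vl.
have [b [zb Vb rb]] := reaches_right_node isV rV sr rA Vr.
have rr := rlt_rpred sr rA.
exists a, b; split=> //; apply/(is_walk_succ _ _ _ _ rr); split=> //.
  by exists 0.
split=> m; rewrite /node_idx /inner_idx /link_idx.
- by case: eqP.
- by lia.
- move=> m01; have -> : m = 0 by lia.
  by split=> //; exists s.
- by lia.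
Qed.

End Gluing.

(** * Sums of lengths over index ranges *)

Section SegmentLengths.
Local Open Scope ring_scope.
Implicit Types (f g : int -> cnf) (l m h k : int).

(** The value of [walk_length] on a two-ended walk whose constituents have the lengths f. *)
Definition seg (f : int -> cnf) (l h : int) : cnf := \sum_(i < `|h - l|%N) f (l + i%:Z).

Lemma seg_cat f l m h : l <= m -> m <= h -> seg f l h = seg f l m + seg f m h.
Proof.
move=> lm mh; rewrite /seg.
have -> : `|h - l|%N = (`|m - l| + `|h - m|)%N by lia.
rewrite big_split_ord /=; congr (_ + _); apply: eq_bigr => i _; congr f; lia.
Qed.

Lemma seg_ext f g l h : l <= h -> (forall m, l <= m < h -> f m = g m) -> seg f l h = seg g l h.
Proof. by move=> lh fg; apply: eq_bigr => i _; apply: fg; have := ltn_ord i; lia. Qed.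

Lemma seg_shift f l h k : seg (fun m => f (m - k)) (l + k) (h + k) = seg f l h.
Proof.
rewrite /seg; have -> : `|(h + k)%R - (l + k)%R|%N = `|h - l|%N by lia.
by apply: eq_bigr => i _; congr f; lia.
Qed.

Lemma seg1 f l : seg f l (l + 1) = f l.
Proof.
rewrite /seg; have -> : `|(l + 1)%R - l|%N = 1%N by lia.
by rewrite big_ord_recl big_ord0 addr0 addr0.
Qed.

Lemma seg_glue f g l1 h l h2 : l1 <= h -> l <= h2 ->
  seg (glue h (h - l) f g) l1 (h - l + h2) = seg f l1 h + seg g l h2.
Proof.
move=> l1h lh2; rewrite (@seg_cat _ _ h) //; last by lia.
congr (_ + _); first by apply: seg_ext => // m mh; rewrite /glue; case: ltP => // ?; lia.
rewrite -(seg_shift g l h2 (h - l)).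
have -> : l + (h - l) = h by lia.
have -> : h2 + (h - l) = h - l + h2 by lia.
apply: seg_ext => [|m mh]; first by lia.
by rewrite /glue; case: ltP => // ?; lia.
Qed.

Lemma seg_le f l m h : l <= m -> m <= h -> cnf_le (seg f l m) (seg f l h).
Proof. by move=> lm mh; rewrite (seg_cat f lm mh); exact: cnf_le_addr. Qed.

Lemma seg_upd f l h c : l < h -> cnf_le (seg (upd f l c) l h) (c + seg f l h).
Proof.
move=> lh; rewrite !(@seg_cat _ l (l + 1) h); try lia.
rewrite !seg1 /upd eqxx; apply: cnf_leD; first exact: cnf_le_refl.
rewrite (@seg_ext _ f); first exact: cnf_le_addl; first by lia.
by move=> m lm; case: eqP => //; lia.
Qed.

End SegmentLengths.

(** * Joining walks of equal natural rank *)

Section Joining.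
Local Open Scope ring_scope.
Local Open Scope classical_set_scope.
Variables (nu : wrank) (G : wstructure).
Hypothesis hG : is_wgraph nu G.
Variable E : set (set (node G)).
Implicit Types (W V Z : walk (node G)) (lo hi : option int) (m k l h p : int).
Implicit Types (x : int -> node G) (w : int -> walk (node G)) (z y c : node G).

(** The two bounds are proved together: the first, for the constituents, gives the second, which in
    turn gives the first for two-ended walks. The factor 2 is due to endless walks. *)
Lemma walk_length_bound W s : is_walk W -> rank_of W = Some s ->
  (forall r, rlt s r -> r <> Arrow -> cnf_le (walk_length W) (omega_pow r *+ 2)) /\
  (s <> Arrow -> lfin W -> rfin W ->
    exists mu, cnf_le (walk_length W) (omega_pow s *+ mu)).
Proof.
elim: W s => [//|r lo hi x w IH] s isW [<-].
have two : r <> Arrow -> lfin (Walk r lo hi x w) -> rfin (Walk r lo hi x w) ->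
    exists mu, cnf_le (walk_length (Walk r lo hi x w)) (omega_pow r *+ mu).
  (* There are [|h - l|] constituents, each of length at most w^r * 2. *)
  case: lo hi isW => [l|] [h|] // isW rA _ _; exists (2 * `|h - l|)%N.
  rewrite mulrnA; apply: cnf_le_sum => i.
  have li : link_idx (Some l) (Some h) (l + i%:Z).
    have lh := walk_two_nodes isW.
    by rewrite /link_idx /=; have := ltn_ord i; lia.
  case: r rA isW => [[|n]||] // _ isW.
  - have [_ [_ [_ ->//]]] := isW.
    by rewrite -{1}[omega_pow _]mulr1n; exact: cnf_leMn.
  - have [_ [lw [_ _ C _]]] := isW; have [_ [s' rs sr] _ _] := C _ li.
    exact: (IH _ _ (lw _ li) rs).1.
  - have [_ [lw [_ _ C _]]] := isW; have [_ [s' rs sr] _ _] := C _ li.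
    exact: (IH _ _ (lw _ li) rs).1.
split=> // r' rr' r'A.
have one : cnf_le (one_ended_length r) (omega_pow r' *+ 2).
  apply: cnf_le_trans (one_ended_length_le rr' r'A) _.
  by rewrite -{1}[omega_pow _]mulr1n; exact: cnf_leMn.
have [rA|rA] := pselect (r = Arrow).
  subst r; have /is_walk_arrow [_ _ inf _] := isW.
  case: (lo) (hi) inf => [l|] [h|] [] // _; try exact: one;
    by apply: cnf_leMn2; exact: (one_ended_length_le rr' r'A).
case: lo hi isW two {IH} => [l|] [h|] isW two //=.
  have [mu mule] := two rA isT isT.
  apply: cnf_le_trans mule _; apply: cnf_le_trans (omega_pow_lt mu rA rr' r'A) _.
  by rewrite -{1}[omega_pow _]mulr1n; exact: cnf_leMn.
by apply: cnf_leMn2; exact: one_ended_length_le.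
Qed.

Definition good W := is_walk W /\ branches_in E W.

Lemma good_rev W : good W -> good (rev_walk W).
Proof. by move=> [? ?]; split; [exact: is_walk_rev|exact: branches_in_rev]. Qed.

Lemma branches_in_glue r lo1 h' h x1 w1 l hi2 x2 w2 : h <= h' ->
  branches_in E (Walk r lo1 (Some h') x1 w1) ->
  branches_in E (Walk r (Some l) hi2 x2 w2) ->
  branches_in E (Walk r lo1 (omap (+%R (h - l)) hi2)
    (glue h (h - l) x1 x2) (glue h (h - l) w1 w2)).
Proof.
move=> hh' b1 b2 m mi; rewrite /glue; case: ltP => mh.
  by apply: b1; move: mi; rewrite /link_idx; case: (lo1) (hi2) => [a|] [b|] /=; lia.
by apply: b2; move: mi; rewrite /link_idx; case: (lo1) (hi2) => [a|] [b|] /=; lia.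
Qed.

Lemma glue_reaches_left r lo1 hi1 h x1 w1 l hi2 x2 w2 z :
  is_walk (Walk r lo1 (omap (+%R (h - l)) hi2)
    (glue h (h - l) x1 x2) (glue h (h - l) w1 w2)) ->
  (if lo1 is Some l1 then l1 < h \/ l1 = h /\ x2 l = x1 h else True) ->
  reaches_left (Walk r lo1 hi1 x1 w1) z ->
  reaches_left (Walk r lo1 (omap (+%R (h - l)) hi2)
    (glue h (h - l) x1 x2) (glue h (h - l) w1 w2)) z.
Proof.
move=> isW H; apply: (reaches_left_agree hG (M := h - 1) isW).
  by move=> m mh; rewrite /glue; have -> : (m < h) = true by lia.
case: (lo1) H => // l1; rewrite /glue => -[-> //|[-> <-]].
by rewrite ltxx; congr x2; lia.
Qed.

Lemma glue_reaches_right r lo1 h x1 w1 l hi2 x2 w2 z :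
  is_walk (Walk r lo1 (omap (+%R (h - l)) hi2)
    (glue h (h - l) x1 x2) (glue h (h - l) w1 w2)) ->
  node_idx (Some l) hi2 l ->
  reaches_right (Walk r (Some l) hi2 x2 w2) z ->
  reaches_right (Walk r lo1 (omap (+%R (h - l)) hi2)
    (glue h (h - l) x1 x2) (glue h (h - l) w1 w2)) z.
Proof.
move=> isW H; have ge m T (a b : int -> T) : l <= m -> glue h (h - l) a b (m + (h - l)) = b m.
  by move=> lm; rewrite /glue; case: ifP => [|_]; [lia|congr b; lia].
apply: (reaches_right_agree hG (M := l) isW).
  by move=> m lm; rewrite !ge.
by case: (hi2) H => // h2 H; apply: ge; move: H; rewrite /node_idx; lia.
Qed.

Lemma walk_length_seg r l h x w : walk_length (Walk r (Some l) (Some h) x w) =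
  seg (@walk_length _ \o w) l h.
Proof. by []. Qed.

(** Only an inequality, since the constituents of the first walk from h on are discarded. *)
Lemma glue_length r l1 h' h x1 w1 l h2 x2 w2 : l1 <= h -> h <= h' -> l <= h2 ->
  cnf_le (walk_length (Walk r (Some l1) (Some (h - l + h2))
    (glue h (h - l) x1 x2) (glue h (h - l) w1 w2)))
  (walk_length (Walk r (Some l1) (Some h') x1 w1) +
   walk_length (Walk r (Some l) (Some h2) x2 w2)).
Proof.
move=> l1h hh' lh2; rewrite !walk_length_seg.
rewrite (@seg_ext _ (glue h (h - l) (@walk_length _ \o w1) (@walk_length _ \o w2))).
- rewrite seg_glue //; apply: cnf_leD; last exact: cnf_le_refl.
  exact: seg_le.
- by lia.
- by move=> m _; rewrite /glue /=; case: ifP.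
Qed.

(** The excess [omega_pow r *+ 2] pays for one new constituent. Finiteness of the outer sides is
    recorded because it decides whether a wtip survives there. *)
Definition joined r W1 W2 z1 z2 W := [/\ good W, rank_of W = Some r, nontrivial W,
  lfin W = lfin W1 /\ rfin W = rfin W2 &
  [/\ reaches_left W z1, reaches_right W z2 & lfin W1 -> rfin W2 ->
    cnf_le (walk_length W) (walk_length W1 + walk_length W2 + omega_pow r *+ 2)]].

Definition join_at r := forall W1 W2 y z1 z2, good W1 -> good W2 ->
  rank_of W1 = Some r -> rank_of W2 = Some r -> nontrivial W1 -> nontrivial W2 ->
  rfin W1 -> lfin W2 -> reaches_left W1 z1 -> reaches_right W1 y ->
  reaches_left W2 y -> reaches_right W2 z2 ->
  exists W, joined r W1 W2 z1 z2 W.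

(** The two terminal wnodes at y have rank 0 and are embraced by y, so they coincide and plain
    concatenation works. *)
Lemma join_at0 : join_at (Nat 0).
Proof.
move=> [//|r lo1 [h|] x1 w1] // [//|r2 [l|] hi2 x2 w2] // y z1 z2.
move=> [isW1 bW1] [isW2 bW2] [er] [er2] [m1 l1i] [m2 l2i] _ _.
subst r r2 => z1l yr yl z2r.
have hi : node_idx lo1 (Some h) h.
  by move: l1i; rewrite /link_idx /node_idx lexx; case: (lo1) => [a|] /=; lia.
have li : node_idx (Some l) hi2 l.
  by move: l2i; rewrite /link_idx /node_idx lexx; case: (hi2) => [a|] /=; lia.
have [_ [_ [A1 B1]]] := isW1; have [_ [_ [A2 B2]]] := isW2.
have e : x1 h = x2 l.
  have yv : embraces y (x2 l) by move: yl; rewrite /reaches_left /= opprK.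
  by apply: (embraced_same_rank hG yr yv); rewrite A1 // A2.
have isW : is_walk (Walk (Nat 0) lo1 (omap (+%R (h - l)) hi2)
    (glue h (h - l) x1 x2) (glue h (h - l) w1 w2)).
  split.
    exists h; move: li hi; rewrite /node_idx; case: (lo1) (hi2) => [a|] [b|] /=; lia.
  split.
    rewrite /glue => m mi; case: ltP => mh.
      apply: (walk_links isW1); move: mi.
      by rewrite /link_idx; case: (lo1) (hi2) => [a|] [b|] /=; lia.
    apply: (walk_links isW2); move: mi.
    by rewrite /link_idx; case: (lo1) (hi2) => [a|] [b|] /=; lia.
  split; rewrite /glue => m mi.
    case: ltP => mh.
      by apply: A1; move: mi; rewrite /node_idx; case: (lo1) (hi2) => [a|] [b|] /=; lia.
    by apply: A2; move: mi; rewrite /node_idx; case: (lo1) (hi2) => [a|] [b|] /=; lia.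
  have [mh|mh] := ltP m h.
    rewrite B1; last first.
      by move: mi; rewrite /link_idx; case: (lo1) (hi2) => [a|] [b|] /=; lia.
    congr Branch; case: ltP => // hm1.
    have -> : m + 1 = h by lia.
    by rewrite e; congr x2; lia.
  have -> : (m + 1 < h) = false by lia.
  rewrite B2; last first.
    by move: mi; rewrite /link_idx; case: (lo1) (hi2) => [a|] [b|] /=; lia.
  by congr Branch; congr x2; lia.
exists (Walk (Nat 0) lo1 (omap (+%R (h - l)) hi2)
    (glue h (h - l) x1 x2) (glue h (h - l) w1 w2)); split=> //.
- by split=> //; exact: branches_in_glue bW1 bW2.
- exists m1; move: l1i li; rewrite /link_idx /node_idx.
  by case: (lo1) (hi2) => [a|] [b|] /=; lia.
- by split=> //; case: (hi2).
split.
- apply: (glue_reaches_left isW) z1l; move: l1i.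
  by rewrite /link_idx; case: (lo1) => // a /=; lia.
- exact: (glue_reaches_right isW).
case: (lo1) (hi2) hi li => [a|] [b|] // hi li _ _.
apply: cnf_le_trans (cnf_le_addr _ _); apply: glue_length.
- by move: hi; rewrite /node_idx; lia.
- exact: lexx.
- by move: li; rewrite /node_idx; lia.
Qed.

(* The condition on the finite sides excludes that one of the constituents
   reaches the junction through a wtip of rank r - 1, in which case the junction
   can be kept as a wnode of the joined r-walk. *)
Definition constituents_join r := forall V1 V2 s1 s2 y z1 z2, good V1 -> good V2 ->
  nontrivial V1 -> nontrivial V2 ->
  rank_of V1 = Some s1 -> rlt s1 r -> rank_of V2 = Some s2 -> rlt s2 r ->
  reaches_left V1 z1 -> reaches_right V1 y -> reaches_left V2 y ->
  reaches_right V2 z2 ->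
  (rpred r = Some s1 -> rfin V1) -> (rpred r = Some s2 -> lfin V2) ->
  exists V s, [/\ good V, nontrivial V, rank_of V = Some s /\ rlt s r,
    reaches_left V z1 /\ reaches_right V z2 &
    (rk z1 = r -> top_tip_left V1 z1 -> top_tip_left V z1) /\
    (rk z2 = r -> top_tip_right V2 z2 -> top_tip_right V z2)].

(** The construction common to all cases of the join: the first walk up to p, the junction wnode c,
    then Z in place of the first constituent of the second walk, then the rest of that walk. *)
Lemma splice_joined r lo1 h x1 w1 l hi2 x2 w2 p c Z s z1 z2 :
  rpred r <> None -> r <> Arrow ->
  good (Walk r lo1 (Some h) x1 w1) -> good (Walk r (Some l) hi2 x2 w2) ->
  link_idx (Some l) hi2 l -> p <= h -> node_idx lo1 None p ->
  rle (rk c) r -> good Z -> nontrivial Z -> rank_of Z = Some s -> rlt s r ->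
  reaches_left Z c -> reaches_right Z (x2 (l + 1)) ->
  (rk (x2 (l + 1)) = r -> top_tip_right (w2 l) (x2 (l + 1)) ->
    top_tip_right Z (x2 (l + 1))) ->
  (link_idx lo1 None (p - 1) -> reaches_right (w1 (p - 1)) c /\
    rk c = r /\ (top_tip_right (w1 (p - 1)) c \/ top_tip_left Z c)) ->
  (if lo1 is Some l1 then l1 < p \/ l1 = p /\ c = x1 p else True) ->
  reaches_left (Walk r lo1 (Some h) x1 w1) z1 ->
  reaches_right (Walk r (Some l) hi2 x2 w2) z2 ->
  exists W, joined r (Walk r lo1 (Some h) x1 w1) (Walk r (Some l) hi2 x2 w2) z1 z2 W.
Proof.
move=> rr rA [isW1 bW1] [isW2 bW2] li ph pi cr [isZ bZ] ntZ rZ sr Zl Zr Ztop J lp z1l z2r.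
have isW2' := set_first_succ rr isW2 li cr isZ ntZ rZ sr Zl Zr Ztop.
have bW2' : branches_in E (Walk r (Some l) hi2 (upd x2 l c) (upd w2 l Z)).
  by move=> m mi; rewrite /upd; case: eqP => // _; exact: bW2.
have nli : node_idx (Some l) hi2 l.
  by move: li; rewrite /link_idx /node_idx; case: (hi2) => [b|] /=; lia.
have updc : upd x2 l c l = c by rewrite /upd eqxx.
have updZ : upd w2 l Z l = Z by rewrite /upd eqxx.
have isW : is_walk (Walk r lo1 (omap (+%R (p - l)) hi2)
    (glue p (p - l) x1 (upd x2 l c)) (glue p (p - l) w1 (upd w2 l Z))).
  apply: (glue_succ rr isW1 ph pi isW2'); rewrite updc updZ.
  by move=> /J [rc Jc]; split.
have z2r' : reaches_right (Walk r (Some l) hi2 (upd x2 l c) (upd w2 l Z)) z2.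
  have := @reaches_right_agree nu G hG r (Some l) (Some l) hi2 x2 w2
    (upd x2 l c) (upd w2 l Z) (l + 1) 0 z2.
  have -> : omap (+%R 0) hi2 = hi2 by case: (hi2) => // b /=; rewrite add0r.
  apply=> //.
    by move=> m lm; rewrite addr0 /upd; have -> : (m == l) = false by lia.
  case: (hi2) li => // b; rewrite /link_idx addr0 /upd => lb.
  by have -> : (b == l) = false by lia.
exists (Walk r lo1 (omap (+%R (p - l)) hi2)
    (glue p (p - l) x1 (upd x2 l c)) (glue p (p - l) w1 (upd w2 l Z))).
split=> //.
- by split=> //; exact: branches_in_glue bW1 bW2'.
- exists p; move: li pi; rewrite /link_idx /node_idx.
  by case: (lo1) (hi2) => [a|] [b|] /=; lia.
- by split=> //; case: (hi2).
split.
- by apply: (glue_reaches_left isW) z1l; rewrite updc.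
- exact: (glue_reaches_right isW).
case: (lo1) (hi2) pi nli li => [a|] [b|] // pi nli li _ _.
have ap : a <= p by move: pi; rewrite /node_idx; lia.
have lb : l < b by move: li; rewrite /link_idx; lia.
apply: cnf_le_trans (glue_length _ _ _ _ _ ap ph (ltW lb)) _.
rewrite -addrA; apply: cnf_leD; first exact: cnf_le_refl.
rewrite !walk_length_seg.
rewrite (@seg_ext _ (upd (@walk_length _ \o w2) l (walk_length Z))).
- apply: cnf_le_trans (seg_upd _ _ lb) _; rewrite addrC.
  apply: cnf_leD; last exact: cnf_le_refl.
  exact: (walk_length_bound isZ rZ).1.
- exact: ltW.
- by move=> m _; rewrite /upd /=; case: eqP.
Qed.

Lemma last_link_idx lo h m : link_idx lo (Some h) m ->
  [/\ [/\ link_idx lo (Some h) (h - 1), node_idx lo (Some h) h & node_idx lo None h],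
      node_idx lo (Some h) (h - 1) /\ node_idx lo None (h - 1) &
      if lo is Some l then l < h else True].
Proof. by rewrite /link_idx /node_idx; case: lo => [a|] /= mi; do !split=> //; lia. Qed.

Lemma first_link_idx l hi m : link_idx (Some l) hi m ->
  link_idx (Some l) hi l /\ node_idx (Some l) hi l.
Proof. by rewrite /link_idx /node_idx; case: hi => [b|] /= mi; split=> //; lia. Qed.

Lemma join_at_succ r : rpred r <> None -> r <> Arrow -> constituents_join r ->
  join_at r.
Proof.
move=> rr rA CJ [//|r1 lo1 [h|] x1 w1] // [//|r2 [l|] hi2 x2 w2] // y z1 z2.
have inner1 : link_idx lo1 None (h - 1 - 1) -> inner_idx lo1 (Some h) (h - 1).
  by rewrite /link_idx /inner_idx; case: (lo1) => [a|] /=; lia.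
have link2 : link_idx lo1 None (h - 1 - 1) -> link_idx lo1 (Some h) (h - 1 - 1).
  by rewrite /link_idx; case: (lo1) => [a|] /=; lia.
have h1h : h - 1 <= h by lia.
move=> gW1 gW2 [er] [er2] [m1 l1i] [m2 l2i] _ _ z1l yu.
subst r1 r2 => yv' z2r.
have yv : embraces y (x2 l) by move: yv'; rewrite /reaches_left /= opprK.
have [isW1 bW1] := gW1; have [isW2 bW2] := gW2.
have [[h1i hn hn'] [hn1 hn1'] lo1h] := last_link_idx l1i.
have [li ln] := first_link_idx l2i.
have lo1h1 : if lo1 is Some l1 then l1 < h - 1 \/ l1 = h - 1 else True.
  by clear -lo1h; case: lo1 lo1h => // a ah; lia.
have [_ lw1 [A1 B1 C1 D1]] := (is_walk_succ lo1 (Some h) x1 w1 rr).1 isW1.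
have [_ lw2 [A2 B2 C2 D2]] := (is_walk_succ (Some l) hi2 x2 w2 rr).1 isW2.
have [nt1 [s1 rs1 sr1] V1l] := C1 _ h1i; rewrite subrK => V1r.
have [nt2 [s2 rs2 sr2] V2l V2r] := C2 _ li.
have gV1 : good (w1 (h - 1)) by split; [exact: lw1|exact: bW1].
have gV2 : good (w2 l) by split; [exact: lw2|exact: bW2].
(* The wtip belongs to a wnode of rank r embraced by [x1 h], whose own rank is at most r; so the two
   are equal. *)
have topu : rpred r = Some s1 -> ~~ rfin (w1 (h - 1)) ->
    rk (x1 h) = r /\ top_tip_right (w1 (h - 1)) (x1 h).
  move=> rs fV.
  have [b [ub _ _ pb]] := reaches_right_end hG gV1.1 rs1 V1r.
  have rb : rk b = r by exact: rpred_inj (pb fV) rs.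
  have ru : rk (x1 h) = r.
    have [->//|] := embraces_rank hG ub.
    by rewrite rb rltNge A1.
  by split=> //; exact: (top_tip_rightP (etrans (congr1 rpred ru) rs) rs1 fV V1r).
have topv : rpred r = Some s2 -> ~~ lfin (w2 l) ->
    rk (x2 l) = r /\ top_tip_left (w2 l) (x2 l).
  move=> rs fV.
  have [b [ub _ _ pb]] := reaches_right_end hG (is_walk_rev gV2.1)
    (etrans (rank_of_rev _) rs2) V2l.
  have rb : rk b = r by apply: rpred_inj rs; apply: pb; rewrite rfin_rev.
  have rv : rk (x2 l) = r.
    have [->//|] := embraces_rank hG ub.
    by rewrite rb rltNge A2.
  by split=> //; exact: (top_tip_leftP (etrans (congr1 rpred rv) rs) rs2 fV V2l).
(* Here [x1 h] has rank r and therefore embraces [x2 l]: it is kept as the junction, and [w2 l]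
   reaches it as well. *)
have [[rs fV]|noA] := pselect (rpred r = Some s1 /\ ~~ rfin (w1 (h - 1))).
  have [ru tu] := topu rs fV.
  have uv : embraces (x1 h) (x2 l).
    by apply: (embraces_rle_embraces hG yu yv); rewrite ru; exact: A2.
  apply: (splice_joined (p := h) (c := x1 h) (Z := w2 l) rr rA gW1 gW2 li) => //.
  - by rewrite ru rle_refl.
  - exact: rs2.
  - exact: sr2.
  - exact: reaches_left_up uv V2l.
  - by move=> _; split=> //; split=> //; left.
  - by move: lo1h; case: (lo1) => // a; left.
have [[rs fV]|noB] := pselect (rpred r = Some s2 /\ ~~ lfin (w2 l)).
  have [rv tv] := topv rs fV.
  have vu : embraces (x2 l) (x1 h).
    by apply: (embraces_rle_embraces hG yv yu); rewrite rv; exact: A1.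
  apply: (splice_joined (p := h) (c := x2 l) (Z := w2 l) rr rA gW1 gW2 li) => //.
  - by rewrite rv rle_refl.
  - exact: rs2.
  - exact: sr2.
  - by move=> _; split; [exact: reaches_right_up vu V1r|split=> //; right].
  - by move: lo1h; case: (lo1) => // a; left.
have [||Z [s [gZ ntZ [rZ sr] [Zl Zr] [Ztl Ztr]]]] := CJ _ _ _ _ y _ _ gV1 gV2 nt1 nt2
  rs1 sr1 rs2 sr2 V1l (reaches_right_up yu V1r) (reaches_left_up yv V2l) V2r.
- by move=> rs; apply: contrapT => /negP fV; exact: noA.
- by move=> rs; apply: contrapT => /negP fV; exact: noB.
(* Z merges the two constituents adjacent to y, so the first walk is cut one constituent earlier. *)
apply: (splice_joined (p := h - 1) (c := x1 (h - 1)) (Z := Z) rr rA gW1 gW2 li) => //.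
- exact: A1.
- exact: rZ.
- exact: sr.
- move=> i1; split; first by have := C1 _ (link2 i1); rewrite subrK => -[].
  split; first by apply: B1; exact: inner1.
  by have [t|t] := D1 _ (inner1 i1); [left|right; apply: Ztl => //; apply: B1; exact: inner1].
- by move: lo1h1; case: (lo1) => // a [|->]; [left|right].
Qed.

(** Brings two constituents to a common rank by wrapping the lower ones. The final alternative tells
    that a wrapped walk is finite on both sides. *)
Lemma lift_rank n V s z1 z2 : good V -> nontrivial V -> rank_of V = Some s ->
  rle s (Nat n) -> reaches_left V z1 -> reaches_right V z2 ->
  exists V', [/\ good V', nontrivial V', rank_of V' = Some (Nat n),
    reaches_left V' z1 /\ reaches_right V' z2 &
    s = Nat n /\ V' = V \/ [/\ rlt s (Nat n), lfin V' & rfin V']].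
Proof.
move=> gV ntV rV sn Vl Vr; have [es|lt] := rle_eqVlt sn.
  by exists V; split=> //; [rewrite rV es|left].
have [isV bV] := gV.
have [a [b]] := wrap hG (r := Nat n) (ltac:(by [])) isV ntV rV lt Vl Vr.
set V' := Walk _ _ _ _ _ => -[isV' V'l V'r].
exists V'; split=> //; last by right.
- by split=> // m _.
- by exists 0.
Qed.

(** After lifting to rank n the walks are finite at y, by hypothesis or by wrapping. A walk with an
    outer wtip of rank n already has rank n, so it is not wrapped and its infinite side survives the
    join. *)
Lemma constituents_join_nat n : join_at (Nat n) -> constituents_join (Nat n.+1).
Proof.
move=> J V1 V2 s1 s2 y z1 z2 gV1 gV2 nt1 nt2 r1 sr1 r2 sr2 V1l V1r V2l V2r f1 f2.
have le s : rlt s (Nat n.+1) -> rle s (Nat n) by case: s => [m||] //; rewrite rltNge /=; lia.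
have [V1' [gV1' nt1' r1' [V1l' V1r'] c1]] := lift_rank gV1 nt1 r1 (le _ sr1) V1l V1r.
have [V2' [gV2' nt2' r2' [V2l' V2r'] c2]] := lift_rank gV2 nt2 r2 (le _ sr2) V2l V2r.
have [||V [gV rV ntV [lV rfV] [Vl Vr _]]] := J _ _ _ _ _ gV1' gV2' r1' r2' nt1' nt2'
    _ _ V1l' V1r' V2l' V2r'.
- by case: c1 => [[es ->]|[]] //; apply: f1; rewrite es.
- by case: c2 => [[es ->]|[]] //; apply: f2; rewrite es.
exists V, (Nat n); split=> //; first by split=> //; rewrite rltNge /= ltnn.
split.
- move=> rz t; apply: top_tip_leftP rV _ Vl; first by rewrite rz.
  rewrite lV; case: c1 => [[_ ->]|[lt _ _]]; first exact: top_tip_left_lfin t.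
  case: t => _; rewrite rank_of_rev rz r1 => -[es].
  by move: lt; rewrite es => /rlt_irr.
- move=> rz t; apply: top_tip_rightP rV _ Vr; first by rewrite rz.
  rewrite rfV; case: c2 => [[_ ->]|[lt _ _]]; first exact: top_tip_right_rfin t.
  case: t => _; rewrite rz r2 => -[es].
  by move: lt; rewrite es => /rlt_irr.
Qed.

Lemma join_at_nat n : join_at (Nat n).
Proof.
elim: n => [|n IH]; first exact: join_at0.
by apply: join_at_succ => //; exact: constituents_join_nat.
Qed.

End Joining.

(** * Joining walks of rank [Omega] *)

Section JoiningAtOmega.
Local Open Scope ring_scope.
Local Open Scope classical_set_scope.
Variables (nu : wrank) (G : wstructure).
Hypothesis hG : is_wgraph nu G.
Variable E : set (set (node G)).
Implicit Types (W V Z : walk (node G)) (lo hi : option int) (m k l h p i j : int).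
Implicit Types (x : int -> node G) (w : int -> walk (node G)) (z y c : node G).

Lemma nontrivial_left_infinite W : ~~ lfin W -> nontrivial W.
Proof.
case: W => // r [//|] [h|] x w _ /=; last by exists 0.
by exists (h - 1); rewrite /link_idx /=; lia.
Qed.

Lemma arrow_left_infinite j x w : is_walk (Walk Arrow None (Some j) x w) ->
  arrow_links None (Some j) x w j.
Proof.
by move=> /is_walk_arrow [_ _ _ [j' H]]; move: (H); case: (H) => _ [//|[ej]] _ _ _; rewrite -ej.
Qed.

Lemma arrow_right_infinite j x w : is_walk (Walk Arrow (Some j) None x w) ->
  arrow_links (Some j) None x w j.
Proof.
by move=> /is_walk_arrow [_ _ _ [j' H]]; move: (H); case: (H) => [[//|[ej]]] _ _ _ _; rewrite -ej.
Qed.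

(** The constituent is finite on the right, since a right wtip of rank R would force [x (m + 1)] to
    have rank at least R + 1, the rank of [x m]. *)
Lemma arrow_link j x w m : good E (Walk Arrow None (Some j) x w) -> m < j ->
  exists R, [/\ rk (x m) = Nat R.+1, rlt (rk (x (m + 1))) (rk (x m)),
    good E (w m) /\ rank_of (w m) = Some (Nat R), ~~ lfin (w m) /\ rfin (w m) &
    reaches_left (w m) (x m) /\ reaches_right (w m) (x (m + 1))].
Proof.
move=> [isW bW] mj; have [_ _ C _ D] := arrow_left_infinite isW.
have li : link_idx None (Some j) m by [].
have [lt tl rr] := D _ li mj.
have [k rxm] := C m (ltW mj).
have [nN rw _] := tl.
case: k => [|R] in rxm *; first by rewrite rxm in nN.
have rwm : rank_of (w m) = Some (Nat R) by rewrite -rank_of_rev rw rxm.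
exists R; split=> //.
- by split=> //; split; [exact: walk_links isW li|exact: bW].
- split; first exact: top_tip_left_lfin tl.
  apply: contrapT => /negP fw.
  have [b [xb _ _ /(_ fw) pb]] := reaches_right_end hG (walk_links isW li) rwm rr.
  have rb : rk b = Nat R.+1 by exact: rpred_inj pb _.
  by have := rlt_le_trans lt; rewrite rxm -rb => /(_ _ (embraces_rle hG xb)) /rlt_irr.
- by split=> //; exact: top_tip_left_reaches.
Qed.

(* The inner part of a one-ended walk of rank [Arrow] can be merged into a single
   constituent of arbitrarily large natural rank, which can then absorb whatever
   is attached at the inner end. *)
Lemma arrow_collapse j x w n : good E (Walk Arrow None (Some j) x w) ->
  exists i R Z, [/\ i < j /\ (n <= R)%N, rk (x i) = Nat R.+1,
    good E Z /\ rank_of Z = Some (Nat R), ~~ lfin Z /\ rfin Z &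
    reaches_left Z (x i) /\ reaches_right Z (x j)].
Proof.
move=> gW; elim: n => [|n [i [R [Z [[ij nR] rxi [gZ rZ] [lZ fZ] [Zl Zr]]]]]].
  have [|R [rx _ gr fin [rl rr]]] := @arrow_link j x w (j - 1) gW; first by lia.
  exists (j - 1), R, (w (j - 1)); rewrite subrK in rr.
  by split=> //; split=> //; lia.
have [|R' [rx lt [gw rw] [lw fw] [wl wr]]] := @arrow_link j x w (i - 1) gW.
  by lia.
rewrite subrK in wr lt.
have RR' : (R < R')%N by move: lt; rewrite rx rxi rltNge /=; lia.
(* The next constituent has a larger rank R'; lifting Z to R' wraps it, which makes its left side
   finite as the join requires. *)
have [|Z' [gZ' ntZ' rZ' [Z'l Z'r] c]] :=
  lift_rank hG (n := R') gZ (nontrivial_left_infinite lZ) rZ _ Zl Zr.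
  exact: ltnW.
have [lZ' fZ'] : lfin Z' /\ rfin Z'.
  by case: c => [[[e] _]|[]//]; rewrite e ltnn in RR'.
have [W [gW' rW ntW [lW fW] [Wl Wr _]]] := join_at_nat hG gw gZ' rw rZ'
  (nontrivial_left_infinite lw) ntZ' fw lZ' wl wr Z'l Z'r.
exists (i - 1), R', W; split=> //; first by split; lia.
by rewrite lW fW.
Qed.

(** The inner part of V1 is collapsed to a rank R above s and joined with the lifted V2. The result
    ends at a wnode b of rank at most R, below the rank R + 1 of [x i], so b is a valid starting
    wnode. *)
Lemma arrow_join_natural V1 V2 s y z1 z2 : good E V1 -> good E V2 ->
  nontrivial V2 -> rank_of V1 = Some Arrow -> rank_of V2 = Some (Nat s) ->
  rfin V1 -> reaches_left V1 z1 -> reaches_right V1 y -> reaches_left V2 y ->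
  reaches_right V2 z2 ->
  exists V, [/\ good E V, rank_of V = Some Arrow, ~~ lfin V,
    reaches_left V z1 & reaches_right V z2].
Proof.
case: V1 => [//|r lo [j|] x w] // gV1 gV2 nt2 [er] r2 _; subst r.
have lo0 : lo = None by case: gV1 => /is_walk_arrow [_ _ []].
subst lo => V1l yj V2l V2r.
have [i [R [Z [[ij sR] rxi [gZ rZ] [lZ fZ] [Zl Zr]]]]] := arrow_collapse s.+1 gV1.
have [|V2' [gV2' nt2' r2' [V2l' V2r'] c]] := lift_rank hG (n := R) gV2 nt2 r2 _ V2l V2r.
  exact: ltnW.
have [lV2' fV2'] : lfin V2' /\ rfin V2'.
  by case: c => [[[e] _]|[]//]; rewrite e ltnn in sR.
have [W [gW rW ntW [lW fW] [Wl Wr _]]] := join_at_nat hG gZ gV2' rZ r2'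
  (nontrivial_left_infinite lZ) nt2' fZ lV2' Zl (reaches_right_up yj Zr) V2l' V2r'.
have [b [z2b Wb bR _]] := reaches_right_end hG gW.1 rW Wr.
have {}bR : rle (rk b) (Nat R) by apply: bR; rewrite fW.
have [_ _ C _ D] := arrow_left_infinite gV1.1.
have isV : is_walk (Walk Arrow None (Some (i + 1)) (fun m => if m <= i then x m else b)
    (fun m => if m < i then w m else W)).
  apply/is_walk_arrow; split; [by exists i; rewrite /node_idx /=; lia| |by left|].
    move=> m mi; case: ltP => im; last exact: gW.1.
    by apply: (walk_links gV1.1); rewrite /link_idx /=; lia.
  exists (i + 1); split; [by left|by right|..] => m mi.
  - case: leP => im; last exact: rle_natural bR.
    by apply: C; rewrite /node_idx /=; lia.
  - by move: mi; rewrite /link_idx /=; lia.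
  - have [im|im] := ltP m i.
      have -> : (m <= i) = true by lia.
      have -> : (m + 1 <= i) = true by lia.
      by move=> _; apply: D; rewrite /link_idx /=; lia.
    move=> mi1; have -> : m = i by lia.
    rewrite lexx; have -> : (i + 1 <= i) = false by lia.
    split=> //.
      by apply: rle_lt_trans bR _; rewrite rxi rltNge /= ltnn.
    by apply: top_tip_leftP rW _ Wl; [rewrite rxi|rewrite lW].
exists (Walk Arrow None (Some (i + 1)) (fun m => if m <= i then x m else b)
    (fun m => if m < i then w m else W)); split=> //.
- split=> // m mi; case: ltP => im; last exact: gW.2.
  by apply: gV1.2; rewrite /link_idx /=; lia.
- apply: (reaches_left_agree hG (M := i - 1) isV) V1l => // m mi.
  have -> : (m <= i) = true by lia.
  by have -> : (m < i) = true by lia.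
- by rewrite /=; have -> : (i + 1 <= i) = false by lia.
Qed.

(** The second walk is collapsed at its inner end until its first constituent leads to a wnode of
    rank above that of [x1 j1]. Then [x1 j1], which embraces [x2 j2], can start an endless walk with
    ranks increasing on both sides. *)
Lemma arrow_join_arrow j1 x1 w1 j2 x2 w2 z1 z2 :
  good E (Walk Arrow None (Some j1) x1 w1) ->
  good E (Walk Arrow (Some j2) None x2 w2) ->
  embraces (x1 j1) (x2 j2) ->
  reaches_left (Walk Arrow None (Some j1) x1 w1) z1 ->
  reaches_right (Walk Arrow (Some j2) None x2 w2) z2 ->
  exists V, [/\ good E V, rank_of V = Some Arrow, ~~ lfin V /\ ~~ rfin V,
    reaches_left V z1 & reaches_right V z2].
Proof.
move=> gV1 gV2 c2 V1l V2r.
have [_ _ C1 _ D1] := arrow_left_infinite gV1.1.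
have [_ _ C2 D2 _] := arrow_right_infinite gV2.1.
have [n rc] : natural (rk (x1 j1)) by apply: C1; rewrite /node_idx /=.
have [i [R [Z0 [[ij nR] rxi [gZ rZ] [lZ fZ] [Zl Zr]]]]] := arrow_collapse n (good_rev gV2).
rewrite opprK in Zr; pose i2 := - i; pose Z := rev_walk Z0.
have i2j : j2 < i2 by rewrite /i2; lia.
have Zl' : reaches_left Z (x1 j1).
  by rewrite reaches_left_rev; exact: reaches_right_up Zr.
have Zt : top_tip_right Z (x2 i2).
  apply: (top_tip_rightP (s := Nat R)); rewrite ?rxi ?rank_of_rev ?rfin_rev //.
have gZ' : good E Z by exact: good_rev.
(* This shift places [x2 i2] right after [x1 j1], with Z between them. *)
pose k := j1 + 1 - i2.
pose x' := glue (j1 + 1) k x1 x2; pose w' := glue (j1 + 1) k (upd w1 j1 Z) w2.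
have x'1 m : m <= j1 -> x' m = x1 m.
  by rewrite /x' /glue => mj; case: ltP => //; lia.
have x'2 m : j1 < m -> x' m = x2 (m - k).
  by rewrite /x' /glue => mj; case: ltP => //; lia.
have w'1 m : m < j1 -> w' m = w1 m.
  rewrite /w' /glue /upd => mj; have -> : (m < j1 + 1) = true by lia.
  by case: eqP => // e; move: mj; rewrite e ltxx.
have w'j : w' j1 = Z.
  by rewrite /w' /glue /upd eqxx; have -> : (j1 < j1 + 1) = true by lia.
have w'2 m : j1 < m -> w' m = w2 (m - k).
  by rewrite /w' /glue => mj; case: ltP => //; lia.
have good' m : good E (w' m).
  have [mj|jm|->] := ltgtP m j1; last by rewrite w'j.
    by rewrite w'1 //; split; [exact: walk_links gV1.1 _|exact: gV1.2].
  have li : link_idx (Some j2) None (m - k) by rewrite /link_idx /= /k; lia.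
  by rewrite w'2 //; split; [exact: walk_links gV2.1 li|exact: gV2.2].
have isV : is_walk (Walk Arrow None None x' w').
  apply/is_walk_arrow; split; [by exists 0|by move=> m _; apply: (good' m).1|by left|].
  exists j1; split; [by left|by left|..] => m _.
  - have [mj|mj] := leP m j1; first by rewrite x'1 //; exact: C1.
    by rewrite x'2 //; apply: C2; rewrite /node_idx /= /k; lia.
  - rewrite le_eqVlt => /orP[/eqP <-|jm].
      rewrite x'1 // x'2 ?w'j; last by lia.
      have -> : j1 + 1 - k = i2 by rewrite /k; lia.
      split=> //; rewrite rc /i2 rxi rltNge /=; lia.
    rewrite !x'2 ?w'2 //; last by lia.
    have -> : m + 1 - k = m - k + 1 by lia.
    by apply: D2; rewrite ?/link_idx /= /k; lia.
  - move=> mj; rewrite !x'1 ?w'1 //; [|lia|lia].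
    exact: D1.
exists (Walk Arrow None None x' w'); split=> //.
- by split=> // m _; apply: (good' m).2.
- apply: (reaches_left_agree hG (M := j1 - 1) isV) V1l => // m mj.
  by rewrite x'1 ?w'1 //; lia.
- apply: (@reaches_right_agree _ _ hG _ _ _ None _ _ _ _ i2 k _ isV) V2r => // m mi.
  by rewrite x'2 ?w'2 ?addrK //; rewrite /k; lia.
Qed.

(** A walk of rank [Arrow] that is finite at y is infinite on its outer side, so the joined walk
    must be of rank [Arrow] and infinite there. For two such walks, one of their starting wnodes
    embraces the other, both being embraced by y, and reversal reduces to the case that it is the
    first. *)
Lemma constituents_join_omega : constituents_join E Omega.
Proof.
move=> V1 V2 s1 s2 y z1 z2 gV1 gV2 nt1 nt2 r1 sr1 r2 sr2 V1l V1r V2l V2r f1 f2.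
have natl s : s1 = Nat s -> rk z1 = Omega -> ~ top_tip_left V1 z1.
  by move=> es rz [_]; rewrite rank_of_rev r1 rz es.
have natr s : s2 = Nat s -> rk z2 = Omega -> ~ top_tip_right V2 z2.
  by move=> es rz [_]; rewrite r2 rz es.
case: s1 r1 sr1 f1 natl => [s1||] // r1 _ f1 natl;
  case: s2 r2 sr2 f2 natr => [s2||] // r2 _ f2 natr.
(* A rank strictly above both, so that both walks get wrapped and are finite at y. *)
- pose n := (maxn s1 s2).+1.
  have [|V1' [gV1' nt1' r1' [V1l' V1r'] c1]] := lift_rank hG (n := n) gV1 nt1 r1 _ V1l V1r.
    by rewrite /= /n; lia.
  have [|V2' [gV2' nt2' r2' [V2l' V2r'] c2]] := lift_rank hG (n := n) gV2 nt2 r2 _ V2l V2r.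
    by rewrite /= /n; lia.
  have [||V [gV rV ntV _ [Vl Vr _]]] := join_at_nat hG gV1' gV2' r1' r2' nt1' nt2'
    _ _ V1l' V1r' V2l' V2r'.
  + by case: c1 => [[[e]]|[]] //; move: e; rewrite /n; lia.
  + by case: c2 => [[[e]]|[]] //; move: e; rewrite /n; lia.
  exists V, (Nat n); split=> //.
  by split=> [rz /(natl _ erefl rz)|rz /(natr _ erefl rz)].
- have V2r' : reaches_left (rev_walk V2) z2 by rewrite reaches_left_rev.
  have V1r' : reaches_left (rev_walk V1) y by rewrite reaches_left_rev.
  have [V [gV rV lV Vl Vr]] := arrow_join_natural (good_rev gV2) (good_rev gV1)
    (nontrivial_rev nt1) (etrans (rank_of_rev _) r2) (etrans (rank_of_rev _) r1)
    (etrans (rfin_rev _) (f2 erefl)) V2r' V2l V1r' V1l.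
  exists (rev_walk V), Arrow; split; [exact: good_rev|..].
  + exact/nontrivial_rev/nontrivial_left_infinite.
  + by rewrite rank_of_rev.
  + by rewrite reaches_left_rev.
  split=> [rz /(natl _ erefl rz)//|rz _].
  by apply: (top_tip_rightP (s := Arrow)); rewrite ?rz ?rank_of_rev ?rfin_rev.
- have [V [gV rV lV Vl Vr]] := arrow_join_natural gV1 gV2 nt2 r1 r2 (f1 erefl)
    V1l V1r V2l V2r.
  exists V, Arrow; split=> //; first exact: nontrivial_left_infinite.
  split=> [rz _|rz /(natr _ erefl rz)//].
  by apply: (top_tip_leftP (s := Arrow)); rewrite ?rz.
- suff [V [gV rV [lV fV] Vl Vr]] : exists V, [/\ good E V, rank_of V = Some Arrow,
      ~~ lfin V /\ ~~ rfin V, reaches_left V z1 & reaches_right V z2].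
    exists V, Arrow; split=> //; first exact: nontrivial_left_infinite.
    split=> rz _; first by apply: (top_tip_leftP (s := Arrow)); rewrite ?rz.
    by apply: (top_tip_rightP (s := Arrow)); rewrite ?rz.
  have {}f1 := f1 erefl; have {}f2 := f2 erefl.
  case: V1 gV1 r1 f1 V1l V1r {nt1 natl} => [//|r lo1 [j1|] x1 w1] // gV1 [er] _.
  subst r; have lo0 : lo1 = None by case: gV1 => /is_walk_arrow [_ _ []].
  subst lo1 => V1l V1r.
  case: V2 gV2 r2 f2 V2l V2r {nt2 natr} => [//|r [j2|] hi2 x2 w2] // gV2 [er] _.
  subst r; have hi0 : hi2 = None by case: gV2 => /is_walk_arrow [_ _ []].
  subst hi2 => V2l V2r.
  have [c12|c21] := embraced_comparable hG V1r V2l.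
    by apply: arrow_join_arrow gV1 gV2 _ V1l V2r; rewrite opprK in c12.
  rewrite -(opprK j1) in c21.
  have V2r' : reaches_left (rev_walk (Walk Arrow (Some j2) None x2 w2)) z2.
    by rewrite reaches_left_rev.
  have [V [gV rV [lV fV] Vl Vr]] :=
    arrow_join_arrow (good_rev gV2) (good_rev gV1) c21 V2r' V1l.
  exists (rev_walk V); split; [exact: good_rev|by rewrite rank_of_rev|..].
  + by rewrite lfin_rev rfin_rev.
  + by rewrite reaches_left_rev.
  + exact: Vl.
Qed.

End JoiningAtOmega.
Lemma join_at_rank (nu : wrank) (G : wstructure) (hG : is_wgraph nu G)
    (E : set (set (node G))) (r : wrank) : r <> Arrow -> join_at E r.
Proof.
case: r => // [n|] _; first exact: (join_at_nat hG).
by apply: (join_at_succ hG) => //; exact: (constituents_join_omega hG).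
Qed.

(** * Wdistances in multiples of w^rho *)

Section LimitedDistance.
Local Open Scope ring_scope.
Local Open Scope classical_set_scope.
Variables (nu : wrank) (G : wstructure).
Hypothesis hG : is_wgraph nu G.
Variables (rho : wrank) (S : wsubgraph G rho).
Hypotheses (rho_nu : rle rho nu) (rho_arrow : rho <> Arrow).
Hypothesis S_connected : rho_wconnected S.
Implicit Types (x y z : node G) (W : walk (node G)).

Definition near (mu : nat) x y : Prop :=
  exists2 l, wdistance S x y l & cnf_le l (omega_pow rho *+ mu).

Lemma near_mono m n x y : (m <= n)%N -> near m x y -> near n x y.
Proof.
by move=> mn [l d lm]; exists l => //; apply: cnf_le_trans lm (cnf_leMn _ mn).
Qed.

Lemma near_refl x : sub_node S x -> near 0 x x.
Proof.
move=> /(maximal_node_exists hG rho_nu rho_arrow) [x' mx x'x].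
exists 0; last exact: cnf_le0.
by exists x', x'; split=> //; left.
Qed.

(** By well-ordering some walk is shortest, so the length of any one walk bounds the wdistance. *)
Lemma joins_near mu x x' y y' W : maximal_node S x' -> maximal_node S y' ->
  embraces x' x -> embraces y' y -> joins rho (edges S) W x' y' ->
  cnf_le (walk_length W) (omega_pow rho *+ mu) -> near mu x y.
Proof.
move=> mx my x'x y'y jW lW; have [xy|xy] := pselect (x' = y').
  exists 0; last exact: cnf_le0.
  by exists x', y'; split=> //; left.
have [|_ [V jV <-] minV] :=
    @cnf_least [set walk_length V | V in [set V | joins rho (edges S) V x' y']].
  by exists (walk_length W), W.
exists (walk_length V).
  exists x', y'; split=> //; right; split=> //; first by exists V.
  by move=> U jU; apply: minV; exists U.
by apply: cnf_le_trans lW; apply: minV; exists W.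
Qed.

(** A two-ended walk has a rank other than [Arrow], so its length is at most a finite multiple of
    w^rho. *)
Lemma near_exists x y : sub_node S x -> sub_node S y -> exists mu, near mu x y.
Proof.
move=> /(maximal_node_exists hG rho_nu rho_arrow) [x' mx x'x].
move=> /(maximal_node_exists hG rho_nu rho_arrow) [y' my y'y].
have [W jW] := S_connected mx.1 my.1.
suff [mu muW] : exists mu, cnf_le (walk_length W) (omega_pow rho *+ mu).
  by exists mu; exact: joins_near jW muW.
case: W jW => [a b|s [l|] [h|] u w] [isW _] // [srho _ _].
have sA : s <> Arrow by move=> sA; subst s; case/is_walk_arrow: isW => _ _ [].
have [mu lmu] := (walk_length_bound isW erefl).2 sA isT isT.
exists mu; apply: (cnf_le_trans lmu); apply: cnf_leMn2.
exact: omega_pow_le.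
Qed.

(** Wrapping raises the rank to rho without changing the length, a sum with one term. The walk is
    nontrivial, as a single wnode embraced by both x and y would force them to be equal. *)
Lemma joins_rank_rho x y W : maximal_node S x -> maximal_node S y -> x <> y ->
  joins rho (edges S) W x y -> exists V,
    [/\ good (edges S) V /\ nontrivial V, rank_of V = Some rho, lfin V /\ rfin V,
        reaches_left V x /\ reaches_right V y & walk_length V = walk_length W].
Proof.
move=> mx my xy; case: W => [a b|s [l|] [h|] u w] [isW bW] // [srho xu yu].
have ntW : nontrivial (Walk s (Some l) (Some h) u w).
  exists l; have := walk_two_nodes isW; rewrite le_eqVlt => /orP[/eqP lh|].
    by case: xy; apply: (maximal_node_unique hG mx my xu); rewrite lh.
  by rewrite /link_idx /= lexx.
have Wx : reaches_left (Walk s (Some l) (Some h) u w) x.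
  by rewrite /reaches_left /= opprK.
have [es|lt] := rle_eqVlt srho; first by subst s; exists (Walk rho (Some l) (Some h) u w).
have [a [b [isV Vx Vy]]] := wrap hG rho_arrow isW ntW erefl lt Wx yu.
set V := Walk rho _ _ _ _ in isV Vx Vy.
exists V; split=> //; first by split; [split=> // m _; exact: bW|exists 0].
exact: (seg1 (fun=> walk_length (Walk s (Some l) (Some h) u w)) 0).
Qed.

Lemma near_triangle a b x y z : near a x y -> near b y z -> near (a + b + 2) x z.
Proof.
move=> [l1 d1 la] [l2 d2 lb].
have [x' [y1 [mx x'x my1 y1y D1]]] := d1.
have [y2 [z' [my2 y2y mz z'z D2]]] := d2.
(* Both wdistances are measured at the same maximal wnode above y, where the walks meet. *)
have ey := maximal_node_unique hG my1 my2 y1y y2y; subst y2.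
case: (D1) => [[ex el1]|[xy [W1 j1 el1] _]].
  subst y1; apply: (@near_mono b); first by lia.
  by exists l2 => //; exists x', z'.
case: (D2) => [[ez el2]|[yz [W2 j2 el2] _]].
  subst z'; apply: (@near_mono a); first by lia.
  by exists l1 => //; exists x', y1.
have [V1 [[gV1 nt1] r1 [lV1 fV1] [V1x V1y] len1]] := joins_rank_rho mx my1 xy j1.
have [V2 [[gV2 nt2] r2 [lV2 fV2] [V2y V2z] len2]] := joins_rank_rho my1 mz yz j2.
have [W [gW rW ntW [lW fW] [Wx Wz len]]] := join_at_rank hG rho_arrow gV1 gV2
  r1 r2 nt1 nt2 fV1 lV2 V1x V1y V2y V2z.
apply: (joins_near (W := W) mx mz x'x z'z).
  rewrite lV1 in lW; rewrite fV2 in fW.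
  case: W gW rW lW fW Wx Wz {ntW len} => [//|r [l|] [h|] u w] // [isW bW] [er] _ _.
  by subst r; rewrite /reaches_left /= opprK => ux uz; split=> //; rewrite rle_refl.
apply: (cnf_le_trans (len lV1 fV2)); rewrite len1 len2 el1 el2 !mulrnDr.
by apply: cnf_leD; [exact: cnf_leD|exact: cnf_le_refl].
Qed.

End LimitedDistance.

(** * Galaxies of the enlargement *)

Section Galaxies.
Local Open Scope classical_set_scope.
Variable F : set_system nat.
Hypothesis hF : free_ultrafilter F.

Lemma free_ultrafilter_proper : ProperFilter F.
Proof. by have [[]] := hF. Qed.

#[local] Existing Instance free_ultrafilter_proper.

(** A singleton in F would leave its point in the intersection of F, so F contains the complements
    of singletons, and the tail is a finite intersection of these. *)
Lemma free_ultrafilter_tail N : F [set n | (N <= n)%N].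
Proof.
have [ultra cap] := hF.
have cof k : F (~` [set k]).
  have [Fk|//] := in_ultra_setVsetC [set k] ultra.
  suff : (\bigcap_(A in F) A) k by rewrite cap.
  by move=> A FA; have [n [/= -> //]] := filter_ex (filterI Fk FA).
elim: N => [|N IH]; first by apply: filterS filterT.
apply: filterS (filterI IH (cof N)) => n [/= Nn nN].
by rewrite ltn_neqAle Nn andbT; apply/eqP => e; apply: nN.
Qed.

(** Stated for an abstract D so that it applies to [near] with its arguments in either order. The
    set B will hold the wnodes of one rank, which need not be that of x0. *)
Lemma unbounded_spread (T : Type) (A B : set T) (D : nat -> T -> T -> Prop) x0 :
  B `<=` A -> A x0 -> (forall m n x y, (m <= n)%N -> D m x y -> D n x y) ->
  (forall x y, A x -> A y -> exists m, D m x y) ->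
  (forall a b x y z, D a x y -> D b y z -> D (a + b + 2)%N x z) ->
  (forall m, exists2 x, B x & ~ D m x0 x) ->
  exists u : nat -> T, (forall k, B (u k)) /\
    forall i j, (i < j)%N -> ~ D i (u i) (u j).
Proof.
move=> BA Ax0 mono ex tri unb.
have /choice[f fP] : forall m, exists y, B y /\ ~ D m x0 y.
  by move=> m; have [y] := unb m; exists y.
have /choice[b bP] : forall m, exists n, D n x0 (f m).
  by move=> m; apply: ex => //; apply: BA; have [] := fP m.
(* If [D i (u i) (u j)] held, the triangle inequality would bring x0 within [b (t i) + i + 2], hence
   within [t j], of [u j], against the choice of f. *)
pose next k t := (t + b t + k + 2)%N.
pose t := fix t k := if k is k'.+1 then next k' (t k') else 0%N.
have tm i j : (i <= j)%N -> (t i <= t j)%N.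
  move=> /subnK <-; elim: (j - i)%N => // k IH.
  by rewrite addSn /= /next; lia.
exists (fun k => f (t k)); split=> [k|i j ij Dij]; first by have [] := fP (t k).
have [_] := fP (t j); apply.
apply: mono (tri _ _ _ _ _ (bP (t i)) Dij).
by have := tm _ _ ij; rewrite /= /next; lia.
Qed.

Variables (nu : wrank) (G : wstructure).
Hypothesis hG : is_wgraph nu G.
Variables (rho : wrank) (S : wsubgraph G rho).
Hypotheses (rho_nu : rle rho nu) (rho_arrow : rho <> Arrow).
Hypothesis hS : is_wsection S.

Lemma hyper_class_self g x : node_seq S g x -> hyper_class F S g x x.
Proof. by move=> sx; split=> //; apply: filterS filterT. Qed.

Lemma near_limitedly_distant g g' x y mu : node_seq S g x -> node_seq S g' y ->
  F [set n | near S mu (x n) (y n)] ->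
  limitedly_distant F S (hyper_class F S g x) (hyper_class F S g' y).
Proof.
by move=> sx sy Fn; exists x, y; split; [exact: hyper_class_self..|exists mu].
Qed.

Lemma limitedly_distant_near g g' x y :
  limitedly_distant F S (hyper_class F S g x) (hyper_class F S g' y) ->
  exists mu, F [set n | near S mu (x n) (y n)].
Proof.
move=> [x1 [y1 [[_ ex] [_ ey] [mu Fmu]]]]; exists mu.
by apply: filterS (filterI Fmu (filterI ex ey)) => n [/= + [-> ->]].
Qed.

Definition galaxy_at (h : set (nat -> node G)) : galaxy (node G) :=
  galaxy_of F S [set k | hypernode F S k /\ limitedly_distant F S h k].

(** The shifted sequences represent hypernodes, as all the wnodes have the same rank g. A bound mu
    between two of them would hold at some index n >= mu, where the wnodes are more than w^rho * n
    apart. *)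
Lemma spread_infinite g (u : nat -> node G) :
  (forall k, sub_node S (u k) /\ rk (u k) = g) ->
  (forall i j, (i < j)%N -> ~ near S i (u i) (u j)) \/
  (forall i j, (i < j)%N -> ~ near S i (u j) (u i)) ->
  infinite_set (galaxies F S).
Proof.
move=> uS far; pose s j n := u (n + j)%N.
have sS j : node_seq S g (s j) by move=> n; exact: uS.
pose h j := hyper_class F S g (s j).
have hH j : hypernode F S (h j) by exists g, (s j).
have hh j : galaxy_nodes (galaxy_at (h j)) (h j).
  split=> //; apply: (near_limitedly_distant (mu := 0)) => //.
  apply: filterS filterT => n _.
  by apply: (near_refl hG rho_nu rho_arrow); have [] := sS j n.
have inj i j : (i < j)%N -> galaxy_at (h i) <> galaxy_at (h j).
  move=> ij e; case: far => far.
    have := hh j; rewrite -e => -[_ /limitedly_distant_near [mu Fmu]].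
    have [n [/= nij mun]] := filter_ex (filterI Fmu (free_ultrafilter_tail mu)).
    apply: (far (n + i)%N (n + j)%N); first by lia.
    by apply: near_mono nij; lia.
  have := hh i; rewrite e => -[_ /limitedly_distant_near [mu Fmu]].
  have [n [/= nij mun]] := filter_ex (filterI Fmu (free_ultrafilter_tail mu)).
  apply: (far (n + i)%N (n + j)%N); first by lia.
  by apply: near_mono nij; lia.
move=> fin; apply: infinite_nat.
have -> : [set: nat] = (fun j => galaxy_at (h j)) @^-1` galaxies F S.
  by apply/seteqP; split=> // j _; exists (h j).
apply: finite_preimage fin => i j _ _ e.
by have [/inj|/inj ne|] := ltngtP i j => //; case: ne.
Qed.

Lemma one_or_infinitely_many_galaxies :
  galaxies F S = [set principal_galaxy F S] \/ infinite_set (galaxies F S).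
Proof.
have conn := ws_connected hS.
have mono := @near_mono G rho S.
have tri := @near_triangle nu G hG rho S rho_nu rho_arrow.
have ex := @near_exists nu G hG rho S rho_nu rho_arrow conn.
(* An end of any branch of S serves as the base point. *)
have [x0 Sx0 rx0] : exists2 x0, sub_node S x0 & rk x0 = Nat 0.
  have [b Sb] := ws_nonempty hS.
  have [x [y [rx _ _ eb]]] := wg_branch hG (ws_edges hS Sb).
  exists x => //; split; first by rewrite rx; case: (rho).
  by exists x; [exact: EmbSelf|left; exists b => //; rewrite eb; left].
pose B g := [set x | sub_node S x /\ rk x = g].
have sub g : B g `<=` sub_node S by move=> x [].
have [[g unb]|bdd1] := pselect (exists g, forall m, exists2 x, B g x & ~ near S m x0 x).
  right; have [u [uB far]] := unbounded_spread (sub g) Sx0 mono ex tri unb.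
  by apply: (spread_infinite uB); left.
have [[g unb]|bdd2] := pselect (exists g, forall m, exists2 x, B g x & ~ near S m x x0).
  right; have [|||u [uB far]] := @unbounded_spread _ _ _ (fun m x y => near S m y x)
    _ (sub g) Sx0 _ _ _ unb.
  - by move=> m n x y; exact: mono.
  - by move=> x y Sx Sy; exact: ex.
  - by move=> a b x y z xy yz; rewrite (addnC a b); exact: tri yz xy.
  by apply: (spread_infinite uB); right.
left.
have bound (P : nat -> node G -> Prop) :
    ~ (exists g, forall m, exists2 x, B g x & ~ P m x) ->
    forall g, exists m, forall x, B g x -> P m x.
  move=> nP g; apply: contrapT => nb; apply: nP; exists g => m.
  apply: contrapT => nx; apply: nb; exists m => x Bx.
  by apply: contrapT => nPx; apply: nx; exists x.
(* Any two hypernodes are compared through x0; the bounds depend only on their ranks and are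
   therefore uniform in n. *)
have lim h k : hypernode F S h -> hypernode F S k -> limitedly_distant F S h k.
  move=> [g [x [sx ->]]] [g' [y [sy ->]]].
  have [a aP] := bound (fun m x => near S m x x0) bdd2 g.
  have [b bP] := bound (fun m x => near S m x0 x) bdd1 g'.
  apply: (near_limitedly_distant (mu := (a + b + 2)%N)) => //.
  by apply: filterS filterT => n _; apply: tri (aP _ (sx n)) (bP _ (sy n)).
have st0 : standard F S (hyper_class F S (Nat 0) (fun=> x0)).
  by exists x0; rewrite rx0.
have hyp0 : hypernode F S (hyper_class F S (Nat 0) (fun=> x0)).
  by exists (Nat 0), (fun=> x0).
have all : forall h, hypernode F S h ->
    galaxy_of F S [set k | hypernode F S k /\ limitedly_distant F S h k] =
    principal_galaxy F S.
  move=> h hh; congr galaxy_of; apply/seteqP; split=> k [hk _]; split=> //.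
    by exists (hyper_class F S (Nat 0) (fun=> x0)) => //; exact: lim.
  exact: lim.
apply/seteqP; split=> [A [h hh ->]|_ ->]; first exact: all.
by exists (hyper_class F S (Nat 0) (fun=> x0)) => //; rewrite all.
Qed.

End Galaxies.

Local Open Scope classical_set_scope.

Theorem mainTheorem3 (F : set_system nat) (hF : free_ultrafilter F)
    (nu : wrank) (G : wstructure) (hG : is_wgraph nu G)
    (hconn : wconnected nu G) (hnu : rle (Nat 2) nu) (rho : wrank)
    (hrho : rle rho nu) (hrho_arrow : rho <> Arrow) (S : wsubgraph G rho)
    (hS : is_wsection S) :
  galaxies F S = [set principal_galaxy F S] \/ infinite_set (galaxies F S).
Proof. exact: (one_or_infinitely_many_galaxies hF hG hrho hrho_arrow hS). Qed.
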